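(* Let $\Gamma$ be a finitely generated Fuchsian group of the first kind and let $P\subset\mathbb{H}^2$ be a convex fundamental polygon of $\Gamma$ with finitely many sides, with vertices $v_i$, none of which is at infinity. Let $T\subset\Gamma$ be the set of elements mapping $P$ to itself or to one of its neighbors, let $\delta_P$ be the minimum distance between any pair of non-adjacent sides of $P$, and let $\epsilon_P$ be the minimum distance from the midpoint of a side of $P$ to any side adjacent to it. Put $$k^\star=\left\lfloor 1+\frac{\max_{i,j}\delta(v_i,v_j)}{\min(\delta_P,\,2\epsilon_P)}\right\rfloor .$$ Then for all $z,w\in P$, the distance $\delta^\star(z,w)=\inf_{\gamma\in\Gamma}\delta(z,\gamma w)$ between the points $[z]$ and $[w]$ of the quotient surface $S=\mathbb{H}^2/\Gamma$ satisfies $$\delta^\star(z,w)=\min_{\gamma\in T^{k^\star}}\delta(z,\gamma w).$$ Equivalently, if $k_{\min}$ is the minimum positive integer $k$ such that $\delta^\star(z,w)=\min_{\gamma\in T^k}\delta(z,\gamma w)$ for all $z,w\in P$, then $k_{\min}\le k^\star$.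
   Context: $\mathbb{H}^2$ is the hyperbolic plane (Poincaré disk with metric $ds^2=4\,dz\,d\bar z/(1-|z|^2)^2$) and $\delta$ is its distance function. A Fuchsian group is a subgroup $\Gamma$ of the orientation-preserving isometry group $\mathrm{PSU}(1,1)$ acting discontinuously on $\mathbb{H}^2$; it is of the first kind if every point of the boundary circle at infinity is an accumulation point of some orbit of $\Gamma$. Points of $S=\mathbb{H}^2/\Gamma$ are orbits $[z]=\Gamma z$. $P$ is a (closed) convex polygon whose images $\gamma P$, $\gamma\in\Gamma$, tessellate $\mathbb{H}^2$; it contains exactly one representative of each point of $S$, up to identification of boundary points. Its sides are paired by elements of $\Gamma$ mapping $P$ to its edge-adjacent images, and these elements generate $\Gamma$. Two distinct images of $P$ are neighbors if they share a common edge or a common vertex. $T$ contains the identity, and $T^k=\{t_1t_2\cdots t_k: t_i\in T\}$, $T^0=\{1\}$. A minimum over an empty set is $+\infty$. Two sides of $P$ are adjacent if they are distinct and share a vertex; non-adjacent sides are distinct sides which are not adjacent. *)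

(* Defs.v *)
(* Classical reals of the standard library, with Coquelicot. *)
From Stdlib Require Import Reals List ZArith.
From Coquelicot Require Import Coquelicot.
Open Scope R_scope.

Definition H2 : Type := {z : C | Cmod z < 1}.

Definition coord (z : H2) : C := proj1_sig z.

(* A curve from [z] to [w] is given by its real coordinates [x t], [y t],
   0 <= t <= 1.  The functions are defined and C^1 around each point of [0,1],
   which loses no C^1 curve on [0,1]; allowing corners would not change the
   infimum of the lengths. *)
Definition curve (z w : H2) (x y : R -> R) : Prop :=
  (x 0, y 0) = coord z /\ (x 1, y 1) = coord w /\
  forall t, 0 <= t <= 1 ->
    x t ^ 2 + y t ^ 2 < 1 /\
    ex_derive x t /\ ex_derive y t /\
    continuous (Derive x) t /\ continuous (Derive y) t.

(* Integral of ds, where ds^2 = 4 dz dzbar / (1 - |z|^2)^2. *)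
Definition hyp_length (x y : R -> R) : R :=
  RInt (fun t => 2 * sqrt (Derive x t ^ 2 + Derive y t ^ 2)
                   / (1 - (x t ^ 2 + y t ^ 2))) 0 1.

Definition delta (z w : H2) : R :=
  real (Glb_Rbar (fun l => exists x y, curve z w x y /\ l = hyp_length x y)).

Definition is_open (U : H2 -> Prop) : Prop :=
  forall z, U z -> exists e, 0 < e /\ forall w, delta z w < e -> U w.

Definition interior (A : H2 -> Prop) (z : H2) : Prop :=
  exists e, 0 < e /\ forall w, delta z w < e -> A w.

Definition boundary (A : H2 -> Prop) (z : H2) : Prop :=
  forall e, 0 < e ->
    (exists w, delta z w < e /\ A w) /\ (exists w, delta z w < e /\ ~ A w).

Definition is_compact (K : H2 -> Prop) : Prop :=
  forall (I : Type) (U : I -> H2 -> Prop),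
    (forall i, is_open (U i)) ->
    (forall z, K z -> exists i, U i z) ->
    exists l : list I, forall z, K z -> exists i, In i l /\ U i z.

(* The geodesic segment with end-points [a] and [b]. *)
Definition segment (a b z : H2) : Prop := delta a z + delta z b = delta a b.

Definition convex (A : H2 -> Prop) : Prop :=
  forall a b z, A a -> A b -> segment a b z -> A z.

Definition midpoint (a b m : H2) : Prop :=
  delta a m = delta a b / 2 /\ delta m b = delta a b / 2.

Definition image (g : H2 -> H2) (A : H2 -> Prop) (z : H2) : Prop :=
  exists w, A w /\ z = g w.

Definition same_set (A B : H2 -> Prop) : Prop := forall z, A z <-> B z.

(* Elements of PSU(1,1) are identified with the maps they induce on [H2]. *)
Definition PSU11 (g : H2 -> H2) : Prop :=
  exists a b : C, Cmod a ^ 2 - Cmod b ^ 2 = 1 /\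
    forall z, coord (g z) =
      ((a * coord z + b) / (Cconj b * coord z + Cconj a))%C.

Definition subgroup (G : (H2 -> H2) -> Prop) : Prop :=
  (forall g, G g -> PSU11 g) /\
  G (fun z => z) /\
  (forall g h, G g -> G h -> G (fun z => g (h z))) /\
  (forall g, G g ->
     exists h, G h /\ (forall z, h (g z) = z) /\ (forall z, g (h z) = z)).

Definition discontinuous_action (G : (H2 -> H2) -> Prop) : Prop :=
  forall K, is_compact K ->
    exists l : list (H2 -> H2),
      forall g, G g -> (exists z, K z /\ K (g z)) -> In g l.

Definition Fuchsian (G : (H2 -> H2) -> Prop) : Prop :=
  subgroup G /\ discontinuous_action G.

Definition finitely_generated (G : (H2 -> H2) -> Prop) : Prop :=
  exists S : list (H2 -> H2),
    (forall s, In s S -> G s) /\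
    forall L, subgroup L -> (forall s, In s S -> L s) -> forall g, G g -> L g.

(* No orbit point lies on the unit circle, so the orbit point approximating
   [zeta] is automatically different from [zeta]. *)
Definition first_kind (G : (H2 -> H2) -> Prop) : Prop :=
  forall zeta : C, Cmod zeta = 1 ->
    exists z : H2, forall e, 0 < e ->
      exists g, G g /\ Cmod (coord (g z) - zeta)%C < e.

(* The vertices of an n-gon are [v 0], ..., [v (n - 1)] in cyclic order; its
   i-th side joins [v i] to [v (next n i)].  Values [v i], i >= n, are unused. *)
Definition next (n i : nat) : nat := (S i mod n)%nat.

Definition side (n : nat) (v : nat -> H2) (i : nat) : H2 -> Prop :=
  segment (v i) (v (next n i)).

Definition end_of_side (n i k : nat) : Prop := k = i \/ k = next n i.

Definition adjacent (n i j : nat) : Prop :=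
  i <> j /\ exists k, end_of_side n i k /\ end_of_side n j k.

Definition non_adjacent (n i j : nat) : Prop :=
  i <> j /\ ~ adjacent n i j.

(* The sides form a simple closed curve, the boundary of [P]. All vertices lie
   in [H2]; compactness says that [P] does not reach infinity. Interior angles
   equal to pi are allowed, as for the midpoint of a side fixed by an elliptic
   element of order 2, which may or may not be counted as a vertex. *)
Definition convex_polygon (n : nat) (v : nat -> H2) (P : H2 -> Prop) : Prop :=
  (3 <= n)%nat /\
  (forall i j, (i < n)%nat -> (j < n)%nat -> v i = v j -> i = j) /\
  (forall i j z, (i < n)%nat -> (j < n)%nat -> i <> j ->
     side n v i z -> side n v j z ->
     exists k, end_of_side n i k /\ end_of_side n j k /\ z = v k) /\
  is_compact P /\ convex P /\ (exists z, interior P z) /\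
  (forall z, boundary P z <-> exists i, (i < n)%nat /\ side n v i z).

(* The images of [P] cover [H2] and have disjoint interiors, and each side of
   [P] is the image of a side of [P] under a non-trivial element of [G]. *)
Definition fundamental_polygon (G : (H2 -> H2) -> Prop)
    (n : nat) (v : nat -> H2) (P : H2 -> Prop) : Prop :=
  convex_polygon n v P /\
  (forall z, exists g, G g /\ image g P z) /\
  (forall g, G g -> (exists z, interior P z /\ interior P (g z)) ->
     forall z, g z = z) /\
  (forall i, (i < n)%nat ->
     exists g j, G g /\ (exists z, g z <> z) /\ (j < n)%nat /\
       same_set (image g (side n v j)) (side n v i)).

(* [g P] is a neighbor of [P]. *)
Definition neighbor (n : nat) (v : nat -> H2) (P : H2 -> Prop)
    (g : H2 -> H2) : Prop :=
  ~ same_set (image g P) P /\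
  ((exists i j, (i < n)%nat /\ (j < n)%nat /\
      same_set (image g (side n v j)) (side n v i)) \/
   (exists i j, (i < n)%nat /\ (j < n)%nat /\ g (v j) = v i)).

Definition Tset (G : (H2 -> H2) -> Prop) (n : nat) (v : nat -> H2)
    (P : H2 -> Prop) (g : H2 -> H2) : Prop :=
  G g /\ (same_set (image g P) P \/ neighbor n v P g).

Fixpoint set_pow (T : (H2 -> H2) -> Prop) (k : nat) (g : H2 -> H2) : Prop :=
  match k with
  | O => g = (fun z => z)
  | S k' => exists t h, T t /\ set_pow T k' h /\ g = (fun z => t (h z))
  end.

(* The sides are compact, so the infima below are minima unless no such pair of
   sides exists, in which case their value is [p_infty] (this happens for
   [delta_P] when n = 3). *)
Definition delta_P (n : nat) (v : nat -> H2) : Rbar :=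
  Glb_Rbar (fun d => exists i j x y,
    (i < n)%nat /\ (j < n)%nat /\ non_adjacent n i j /\
    side n v i x /\ side n v j y /\ d = delta x y).

Definition epsilon_P (n : nat) (v : nat -> H2) : Rbar :=
  Glb_Rbar (fun d => exists i j m y,
    (i < n)%nat /\ (j < n)%nat /\ adjacent n i j /\
    midpoint (v i) (v (next n i)) m /\ side n v j y /\ d = delta m y).

Definition max_vertex_distance (n : nat) (v : nat -> H2) : Rbar :=
  Lub_Rbar (fun d => exists i j,
    (i < n)%nat /\ (j < n)%nat /\ d = delta (v i) (v j)).

(* [Int_part] is the floor function. *)
Definition kstar (n : nat) (v : nat -> H2) : nat :=
  Z.to_nat (Int_part (1 + real (Rbar_div (max_vertex_distance n v)
    (Rbar_min (delta_P n v) (Rbar_mult 2 (epsilon_P n v)))))).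

Definition delta_star (G : (H2 -> H2) -> Prop) (z w : H2) : R :=
  real (Glb_Rbar (fun d => exists g, G g /\ d = delta z (g w))).

Definition is_min (E : R -> Prop) (m : R) : Prop :=
  E m /\ forall x, E x -> m <= x.

(* [delta_star G z w] is the minimum of [delta z (g w)] over the [g] in [A], for
   all [z] and [w] in [P]. *)
Definition computes_delta_star (G : (H2 -> H2) -> Prop) (P : H2 -> Prop)
    (A : (H2 -> H2) -> Prop) : Prop :=
  forall z w, P z -> P w ->
    is_min (fun d => exists g, A g /\ d = delta z (g w)) (delta_star G z w).

Definition is_k_min (G : (H2 -> H2) -> Prop) (n : nat) (v : nat -> H2)
    (P : H2 -> Prop) (k : nat) : Prop :=
  (0 < k)%nat /\ computes_delta_star G P (set_pow (Tset G n v P) k) /\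
  forall k', (0 < k')%nat ->
    computes_delta_star G P (set_pow (Tset G n v P) k') -> (k <= k')%nat.

(* Main.v *)
(* In the hyperboloid model [cosh (delta z w)] is a Lorentz product, so betweenness, sides of a line
   and convexity become linear algebra in R^3. A point of [P x P] can be perturbed so that the
   geodesic from [z] to [g w] misses all vertices of the tiles [h P], [h] in [T^k]; it then crosses
   sides of successive tiles at interior points. Group the crossed sides greedily into maximal runs
   having a common vertex: the tiles before and after a run share that vertex, so they differ by an
   element of [T]. From the first side of a run to the first side of the next one the geodesic has
   length at least [min(delta_P, 2 epsilon_P)]: either it joins two non-adjacent sides of a tile, or
   it crosses three sides [p a], [p q], [q b] in turn, which takes [2 epsilon_P] by convexity of the
   distance to a ray. As a shortest geodesic is no longer than the diameter of [P], which is attained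
   at vertices, there are at most [kstar] runs. *)

From Stdlib Require Import Reals List ZArith Lra Lia Classical.
From Stdlib Require Import FunctionalExtensionality.
From Coquelicot Require Import Coquelicot.
Require Import Defs.
Open Scope R_scope.

(** The number of sides in a run is not controlled by length: near a vertex a short piece of the
    geodesic can cross several of them. The run is nevertheless worth a single factor, because each
    of its tiles is [h0 t P] with [h0 P] the tile before the run and [t] in [T]; it ends because [T]
    is finite and every tile is left for good. Each run but the last is charged at least
    [m = min(delta_P, 2 epsilon_P)], so [N] runs suffice for a length below [N * m], and
    [floor (1 + x) > x] gives [d < kstar * m] for the diameter [d]. Only [g] with
    [delta z (g w) < d] have to be followed, the identity serving otherwise; this strict inequality
    leaves the room for the perturbation. What is proved for the perturbed pair is that [g] itself
    lies in [T^kstar]. This no longer mentions the pair, so no limit is taken. The factor 2 in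
    [2 epsilon_P] comes from the middle one of three sides: its crossing point has a distance to
    each of the two outer sides, and the sum is compared with the value at the midpoint. *)

(** * Hyperbolic functions *)

Lemma cosh_sqr x : cosh x * cosh x = 1 + sinh x * sinh x.
Proof.
  unfold cosh, sinh. assert (exp x * exp (- x) = 1) by (rewrite <- exp_plus, Rplus_opp_r; apply exp_0).
  nra.
Qed.

Lemma cosh_pos x : 0 < cosh x.
Proof. unfold cosh. pose proof (exp_pos x). pose proof (exp_pos (- x)). lra. Qed.

Lemma cosh_ge1 x : 1 <= cosh x.
Proof. pose proof (cosh_sqr x). pose proof (cosh_pos x). nra. Qed.

Lemma cosh_opp x : cosh (- x) = cosh x.
Proof. unfold cosh. rewrite Ropp_involutive. lra. Qed.

Lemma sinh_opp x : sinh (- x) = - sinh x.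
Proof. unfold sinh. rewrite Ropp_involutive. lra. Qed.

Lemma cosh_add x y : cosh (x + y) = cosh x * cosh y + sinh x * sinh y.
Proof. unfold cosh, sinh. rewrite Ropp_plus_distr, !exp_plus. lra. Qed.

Lemma sinh_add x y : sinh (x + y) = sinh x * cosh y + cosh x * sinh y.
Proof. unfold cosh, sinh. rewrite Ropp_plus_distr, !exp_plus. lra. Qed.

Lemma cosh_sub x y : cosh (x - y) = cosh x * cosh y - sinh x * sinh y.
Proof. unfold Rminus. rewrite cosh_add, cosh_opp, sinh_opp. lra. Qed.

Lemma sinh_sub x y : sinh (x - y) = sinh x * cosh y - cosh x * sinh y.
Proof. unfold Rminus. rewrite sinh_add, cosh_opp, sinh_opp. lra. Qed.

Lemma sinh_ge0 x : 0 <= x -> 0 <= sinh x.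
Proof. intros [H| <-]; [apply sinh_lt in H|]; rewrite sinh_0 in *; lra. Qed.

Lemma sinh_gt0 x : 0 < x -> 0 < sinh x.
Proof. intros H; apply sinh_lt in H; rewrite sinh_0 in *; lra. Qed.

Lemma sinh_le x y : x <= y -> sinh x <= sinh y.
Proof. intros [H| <-]; [apply sinh_lt in H|]; lra. Qed.

Lemma sinh_le_inv x y : sinh x <= sinh y -> x <= y.
Proof. intros H. destruct (Rle_or_lt x y) as [|h]; auto. apply sinh_lt in h. lra. Qed.

Lemma arcsinh_ge0 x : 0 <= x -> 0 <= arcsinh x.
Proof. intros H; apply arcsinh_le in H; rewrite arcsinh_0 in H; lra. Qed.

Lemma arcsinh_gt0 x : 0 < x -> 0 < arcsinh x.
Proof. intros H; apply arcsinh_lt in H; rewrite arcsinh_0 in H; lra. Qed.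

Lemma cosh_le x y : 0 <= x <= y -> cosh x <= cosh y.
Proof.
  intros H. pose proof (cosh_sqr x). pose proof (cosh_sqr y).
  pose proof (cosh_pos x). pose proof (cosh_pos y).
  assert (0 <= sinh x) by (apply sinh_ge0; lra). assert (sinh x <= sinh y) by (apply sinh_le; lra).
  nra.
Qed.

Lemma cosh_lt x y : 0 <= x < y -> cosh x < cosh y.
Proof.
  intros H. pose proof (cosh_sqr x). pose proof (cosh_sqr y).
  pose proof (cosh_pos x). pose proof (cosh_pos y).
  assert (0 <= sinh x) by (apply sinh_ge0; lra). assert (sinh x < sinh y) by (apply sinh_lt; lra).
  nra.
Qed.

Lemma cosh_le_inv x y : 0 <= y -> cosh x <= cosh y -> x <= y.
Proof. intros H h. destruct (Rle_or_lt x y) as [|k]; auto. assert (cosh y < cosh x) by (apply cosh_lt; lra). lra. Qed.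

Lemma cosh_inj x y : 0 <= x -> 0 <= y -> cosh x = cosh y -> x = y.
Proof. intros. apply Rle_antisym; apply cosh_le_inv; lra. Qed.

Lemma cosh_abs x : cosh (Rabs x) = cosh x.
Proof. unfold Rabs; destruct Rcase_abs; [apply cosh_opp|reflexivity]. Qed.

Lemma cosh_double x : cosh (2 * x) = 1 + 2 * (sinh x * sinh x).
Proof. replace (2 * x) with (x + x) by ring. rewrite cosh_add, cosh_sqr. ring. Qed.

Definition arcosh (b : R) : R := arcsinh (sqrt (b * b - 1)).

Lemma arcosh_ge0 b : 0 <= arcosh b.
Proof. apply arcsinh_ge0, sqrt_pos. Qed.

Lemma cosh_arcosh b : 1 <= b -> cosh (arcosh b) = b.
Proof.
  intros H. unfold arcosh. pose proof (cosh_sqr (arcsinh (sqrt (b * b - 1)))) as E.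
  rewrite sinh_arcsinh, sqrt_sqrt in E by nra.
  pose proof (cosh_pos (arcsinh (sqrt (b * b - 1)))). nra.
Qed.

(** * The hyperboloid model *)

Record vec := Vec { c0 : R; c1 : R; c2 : R }.

(** Lorentz form with signs [+ - -]: points of the plane have norm 1, unit tangent vectors and unit
    normals of lines have norm -1. *)
Definition bil (u v : vec) : R := c0 u * c0 v - c1 u * c1 v - c2 u * c2 v.

(** Sums and multiples both go through this operation; a multiple of one vector is written
    [lin s u 0 u]. *)
Definition lin (s : R) (u : vec) (t : R) (v : vec) : vec :=
  Vec (s * c0 u + t * c0 v) (s * c1 u + t * c1 v) (s * c2 u + t * c2 v).

(* Normalised so that [bil (cross a b) x] is the determinant of [a], [b], [x]. *)
Definition cross (a b : vec) : vec :=
  Vec (c1 a * c2 b - c2 a * c1 b) (c0 a * c2 b - c2 a * c0 b) (c1 a * c0 b - c0 a * c1 b).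

Definition hyp (u : vec) : Prop := bil u u = 1 /\ 0 < c0 u.

Lemma bilC u v : bil u v = bil v u.
Proof. unfold bil; ring. Qed.

Lemma bil_linl s u t v w : bil (lin s u t v) w = s * bil u w + t * bil v w.
Proof. unfold bil, lin; simpl; ring. Qed.

Lemma bil_linr s u t v w : bil w (lin s u t v) = s * bil w u + t * bil w v.
Proof. unfold bil, lin; simpl; ring. Qed.

Lemma bil_cross_l a b : bil (cross a b) a = 0.
Proof. unfold bil, cross; simpl; ring. Qed.

Lemma bil_cross_r a b : bil (cross a b) b = 0.
Proof. unfold bil, cross; simpl; ring. Qed.

Lemma bil_cross_swap a b x : bil (cross b a) x = - bil (cross a b) x.
Proof. unfold bil, cross; simpl; ring. Qed.

Lemma bil_cross_rot a b x : bil (cross b x) a = bil (cross a b) x.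
Proof. unfold bil, cross; simpl; ring. Qed.

(** The right-hand side is the Gram determinant; it is a square because the form has determinant +1.
    Its non-negativity yields the speed bound, the triangle inequality and the bound on cosines of
    angles. *)
Lemma gram a b x :
  bil (cross a b) x * bil (cross a b) x =
  bil a a * (bil b b * bil x x - bil b x * bil b x)
  - bil a b * (bil a b * bil x x - bil b x * bil a x)
  + bil a x * (bil a b * bil b x - bil b b * bil a x).
Proof. unfold bil, cross; simpl; ring. Qed.

Lemma cross_sqr a b : bil (cross a b) (cross a b) = bil a a * bil b b - bil a b * bil a b.
Proof. unfold bil, cross; simpl; ring. Qed.

Lemma vec_eq u v : c0 u = c0 v -> c1 u = c1 v -> c2 u = c2 v -> u = v.
Proof. destruct u, v; simpl; intros -> -> ->; reflexivity. Qed.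

(** Reversed Cauchy-Schwarz inequality: the two squares compared differ by
    [(bf-ce)^2 + (b-e)^2 + (c-f)^2]. *)
Lemma bil_hyp_ge1 u v : hyp u -> hyp v -> 1 <= bil u v.
Proof.
  unfold hyp, bil. destruct u as [a b c], v as [d e f]; simpl. intros [H1 H2] [H3 H4].
  assert (1 <= a) by nra. assert (1 <= d) by nra.
  assert ((b*e+c*f+1)^2 <= (a*d)^2).
  { replace ((a*d)^2) with ((1+b*b+c*c)*(1+e*e+f*f)) by (replace (1+b*b+c*c) with (a*a) by lra;
      replace (1+e*e+f*f) with (d*d) by lra; ring).
    assert (0 <= (b*f-c*e)^2) by apply pow2_ge_0.
    assert (0 <= (b-e)^2) by apply pow2_ge_0. assert (0 <= (c-f)^2) by apply pow2_ge_0. nra. }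
  assert (0 < a*d) by nra.
  destruct (Rle_or_lt (b*e+c*f+1) (a*d)); [lra|]. nra.
Qed.

(** Inverse stereographic projection from [(-1, 0, 0)], from the disk to the upper sheet. *)
Definition emb (z : H2) : vec :=
  let x := fst (coord z) in let y := snd (coord z) in
  Vec ((1 + (x * x + y * y)) / (1 - (x * x + y * y)))
      (2 * x / (1 - (x * x + y * y))) (2 * y / (1 - (x * x + y * y))).

Lemma Cmod_lt1 (z : C) : Cmod z < 1 <-> fst z * fst z + snd z * snd z < 1.
Proof.
  unfold Cmod. replace (fst z * fst z + snd z * snd z) with (fst z ^ 2 + snd z ^ 2) by ring.
  split; intros H.
  - rewrite <- sqrt_1 in H. apply sqrt_lt_0_alt in H. exact H.
  - rewrite <- sqrt_1. apply sqrt_lt_1_alt. split; [nra|exact H].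
Qed.

Lemma coord_lt1 (z : H2) : fst (coord z) * fst (coord z) + snd (coord z) * snd (coord z) < 1.
Proof. apply Cmod_lt1, (proj2_sig z). Qed.

Lemma emb_hyp z : hyp (emb z).
Proof.
  pose proof (coord_lt1 z). unfold hyp, emb, bil; simpl.
  set (x := fst (coord z)) in *. set (y := snd (coord z)) in *. split.
  - field. lra.
  - apply Rdiv_lt_0_compat; nra.
Qed.

Lemma H2_eq (z w : H2) : coord z = coord w -> z = w.
Proof.
  destruct z as [z hz], w as [w hw]; unfold coord; simpl. intros ->.
  f_equal. apply proof_irrelevance.
Qed.

Lemma emb_coord z :
  coord z = (c1 (emb z) / (1 + c0 (emb z)), c2 (emb z) / (1 + c0 (emb z))).
Proof.
  pose proof (coord_lt1 z). rewrite (surjective_pairing (coord z)) at 1. unfold emb; simpl.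
  set (x := fst (coord z)) in *. set (y := snd (coord z)) in *. f_equal; field; nra.
Qed.

Lemma emb_inj z w : emb z = emb w -> z = w.
Proof. intros E. apply H2_eq. rewrite !emb_coord, E. reflexivity. Qed.

(** The origin is a default value, never taken on the hyperboloid. *)
Definition unemb (u : vec) : H2 :=
  match Rlt_dec (Cmod (c1 u / (1 + c0 u), c2 u / (1 + c0 u))) 1 with
  | left H => exist _ _ H
  | right _ => exist _ (RtoC 0) (eq_ind_r (fun r => r < 1) Rlt_0_1 Cmod_0)
  end.

Lemma coord_unemb u : hyp u -> coord (unemb u) = (c1 u / (1 + c0 u), c2 u / (1 + c0 u)).
Proof.
  intros [H1 H2]. unfold unemb. destruct Rlt_dec as [h|h]; [reflexivity|].
  exfalso; apply h, Cmod_lt1; simpl. unfold bil in H1.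
  replace (c1 u / (1 + c0 u) * (c1 u / (1 + c0 u)) + c2 u / (1 + c0 u) * (c2 u / (1 + c0 u)))
    with ((c1 u * c1 u + c2 u * c2 u) / ((1 + c0 u) * (1 + c0 u))) by (field; lra).
  apply Rmult_lt_reg_r with ((1 + c0 u) * (1 + c0 u)); [nra|].
  replace ((c1 u * c1 u + c2 u * c2 u) / ((1 + c0 u) * (1 + c0 u)) * ((1 + c0 u) * (1 + c0 u)))
    with (c1 u * c1 u + c2 u * c2 u) by (field; lra). nra.
Qed.

Lemma emb_unemb u : hyp u -> emb (unemb u) = u.
Proof.
  intros Hu. pose proof (coord_unemb u Hu) as E. pose proof (coord_lt1 (unemb u)) as L.
  destruct Hu as [H1 H2]. unfold emb. rewrite E in *. simpl in *. unfold bil in H1.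
  set (p := c0 u) in *. set (q := c1 u) in *. set (r := c2 u) in *.
  assert (D : 1 - (q / (1 + p) * (q / (1 + p)) + r / (1 + p) * (r / (1 + p))) = 2 / (1 + p)).
  { replace (q / (1 + p) * (q / (1 + p)) + r / (1 + p) * (r / (1 + p)))
      with ((q*q + r*r) / ((1 + p)*(1+p))) by (field; lra).
    replace (q*q+r*r) with ((p-1)*(1+p)) by lra. field. lra. }
  rewrite D.
  apply vec_eq; simpl.
  - replace (q / (1 + p) * (q / (1 + p)) + r / (1 + p) * (r / (1 + p))) with (1 - 2 / (1+p)) by lra.
    fold p. field. lra.
  - fold q. field. lra.
  - fold r. field. lra.
Qed.

Lemma unemb_emb z : unemb (emb z) = z.
Proof. apply emb_inj, emb_unemb, emb_hyp. Qed.

(** Equality case of [bil_hyp_ge1]: the same sum of squares vanishes. *)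
Lemma hyp_eq u v : hyp u -> hyp v -> bil u v = 1 -> u = v.
Proof.
  unfold hyp, bil. destruct u as [a b c], v as [d e f]; simpl. intros [H1 H2] [H3 H4] H5.
  assert (a*a = 1+b*b+c*c) by lra. assert (d*d=1+e*e+f*f) by lra.
  assert (K : (b*f-c*e)^2+(b-e)^2+(c-f)^2 = 0).
  { assert ((a*d)^2 = (1+b*b+c*c)*(1+e*e+f*f)) by (rewrite <- H, <- H0; ring).
    replace (a*d) with (1+b*e+c*f) in H6 by lra. nra. }
  assert (b - e = 0). { assert (0 <= (b*f-c*e)^2) by apply pow2_ge_0. assert (0 <= (c-f)^2) by apply pow2_ge_0. nra. }
  assert (c - f = 0). { assert (0 <= (b*f-c*e)^2) by apply pow2_ge_0. assert (0 <= (b-e)^2) by apply pow2_ge_0. nra. }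
  assert (b = e) by lra. assert (c = f) by lra. subst e f.
  assert (a = d) by nra. subst; reflexivity.
Qed.

(** * The distance formula *)

(** Pointwise forms of the rules for [plus_fct] and the like, so that [cont_pt] can select a rule
    from the head symbol of the body. *)
Lemma continuity_pt_fun_plus (f g : R -> R) x : continuity_pt f x -> continuity_pt g x ->
  continuity_pt (fun s => f s + g s) x.
Proof. exact (continuity_pt_plus f g x). Qed.

Lemma continuity_pt_fun_minus (f g : R -> R) x : continuity_pt f x -> continuity_pt g x ->
  continuity_pt (fun s => f s - g s) x.
Proof. exact (continuity_pt_minus f g x). Qed.

Lemma continuity_pt_fun_mult (f g : R -> R) x : continuity_pt f x -> continuity_pt g x ->
  continuity_pt (fun s => f s * g s) x.
Proof. exact (continuity_pt_mult f g x). Qed.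

Lemma continuity_pt_fun_div (f g : R -> R) x : continuity_pt f x -> continuity_pt g x -> g x <> 0 ->
  continuity_pt (fun s => f s / g s) x.
Proof. exact (continuity_pt_div f g x). Qed.

Lemma continuity_pt_fun_sqr (f : R -> R) x : continuity_pt f x -> continuity_pt (fun s => f s ^ 2) x.
Proof.
  intros H. apply (continuity_pt_comp f (fun r => r ^ 2)); auto.
  apply derivable_continuous_pt, derivable_pt_pow.
Qed.

Lemma continuity_pt_fun_sqrt (f : R -> R) x : continuity_pt f x -> 0 <= f x ->
  continuity_pt (fun s => sqrt (f s)) x.
Proof. intros H H0. apply (continuity_pt_comp f sqrt); auto. now apply continuity_pt_sqrt. Qed.

Lemma continuity_pt_fun_const (a x : R) : continuity_pt (fun _ => a) x.
Proof. apply continuity_pt_const. intros ? ?; reflexivity. Qed.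

Ltac cont_pt :=
  repeat lazymatch goal with
  | |- continuity_pt (fun s => _ + _) _ => apply continuity_pt_fun_plus
  | |- continuity_pt (fun s => _ - _) _ => apply continuity_pt_fun_minus
  | |- continuity_pt (fun s => _ * _) _ => apply continuity_pt_fun_mult
  | |- continuity_pt (fun s => _ / _) _ => apply continuity_pt_fun_div
  | |- continuity_pt (fun s => _ ^ 2) _ => apply continuity_pt_fun_sqr
  | |- continuity_pt (fun s => sqrt _) _ => apply continuity_pt_fun_sqrt
  | |- continuity_pt (fun _ => ?a) _ => apply continuity_pt_fun_const
  end; try assumption.

Section Curve.
Variables (x y : R -> R) (t : R).
Hypotheses (Hlt : x t ^ 2 + y t ^ 2 < 1) (Hx : ex_derive x t) (Hy : ex_derive y t)
  (Cx : continuous (Derive x) t) (Cy : continuous (Derive y) t).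

Definition speed (s : R) : R :=
  2 * sqrt (Derive x s ^ 2 + Derive y s ^ 2) / (1 - (x s ^ 2 + y s ^ 2)).

(** Lorentz product of [(a, b, c)] with the curve point lifted to the hyperboloid; for [(a, b, c)]
    of norm -1 it is [sinh] of the signed distance to a line. *)
Definition height (a b c s : R) : R :=
  (a * (1 + (x s ^ 2 + y s ^ 2)) - b * (2 * x s) - c * (2 * y s)) / (1 - (x s ^ 2 + y s ^ 2)).

Definition height' (a b c s : R) : R :=
  (a * (4 * (x s * Derive x s + y s * Derive y s))
   - b * (2 * Derive x s * (1 - (x s ^ 2 + y s ^ 2)) + 4 * x s * (x s * Derive x s + y s * Derive y s))
   - c * (2 * Derive y s * (1 - (x s ^ 2 + y s ^ 2)) + 4 * y s * (x s * Derive x s + y s * Derive y s)))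
  / (1 - (x s ^ 2 + y s ^ 2)) ^ 2.

Lemma is_derive_height a b c : is_derive (height a b c) t (height' a b c t).
Proof.
  unfold height, height'. auto_derive.
  - repeat split; auto. lra.
  - change (Derive (fun s => x s) t) with (Derive x t). change (Derive (fun s => y s) t) with (Derive y t).
    field. simpl in Hlt. lra.
Qed.

Lemma continuous_curve :
  continuity_pt x t /\ continuity_pt y t /\
  continuity_pt (Derive x) t /\ continuity_pt (Derive y) t.
Proof.
  repeat split; apply continuity_pt_filterlim; auto; now apply (ex_derive_continuous (V := R_NormedModule)).
Qed.

Lemma continuous_speed : continuous speed t.
Proof.
  destruct continuous_curve as (h1 & h2 & h3 & h4).
  apply continuity_pt_filterlim. unfold speed.
  cont_pt; [nra|lra].
Qed.

Lemma continuous_height' a b c : continuous (height' a b c) t.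
Proof.
  destruct continuous_curve as (h1 & h2 & h3 & h4).
  apply continuity_pt_filterlim. unfold height'.
  cont_pt. apply pow_nonzero; lra.
Qed.

(* Signed distance to a line is 1-Lipschitz, infinitesimally. *)
Lemma height'_le_speed a b c : a * a - b * b - c * c = -1 ->
  height' a b c t / sqrt (height a b c t ^ 2 + 1) <= speed t.
Proof.
  intros HU.
  set (q := 1 - (x t ^ 2 + y t ^ 2)). assert (Hq : 0 < q) by (unfold q; lra).
  set (w := x t * Derive x t + y t * Derive y t).
  (* [X] is the lifted curve, [V] its velocity, [U] the normal of the line; [speed] is the Lorentz
     length of [V]. *)
  pose (X := Vec ((1 + (x t ^ 2 + y t ^ 2)) / q) (2 * x t / q) (2 * y t / q)).
  pose (V := Vec (4 * w / q ^ 2) (2 * Derive x t / q + 4 * x t * w / q ^ 2)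
                 (2 * Derive y t / q + 4 * y t * w / q ^ 2)).
  pose (U := Vec a b c).
  assert (E1 : height a b c t = bil U X).
  { unfold height, bil, U, X; cbn [c0 c1 c2]; fold q. field. lra. }
  assert (E2 : height' a b c t = bil U V).
  { unfold height', bil, U, V; cbn [c0 c1 c2]; fold q w. field. lra. }
  assert (E3 : bil X X = 1). { unfold bil, X, q; cbn [c0 c1 c2]. field. unfold q in Hq; lra. }
  assert (E4 : bil X V = 0). { unfold bil, X, V, w, q; cbn [c0 c1 c2]. field. unfold q in Hq; lra. }
  assert (E5 : speed t ^ 2 = - bil V V).
  { unfold speed. fold q. unfold Rdiv. rewrite Rpow_mult_distr, Rpow_mult_distr, pow2_sqrt by nra.
    unfold bil, V, w; cbn [c0 c1 c2]. unfold q. field. unfold q in Hq; lra. }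
  assert (E6 : bil U U = -1) by (unfold bil, U; cbn [c0 c1 c2]; lra).
  (* As the left-hand side is a square, this reads [height'^2 <= (height^2 + 1) * speed^2]. *)
  pose proof (gram X U V) as K. rewrite E3, E4, E6, (bilC X U), <- E1, <- E2 in K.
  assert (K2 : height' a b c t ^ 2 <= (height a b c t ^ 2 + 1) * speed t ^ 2).
  { rewrite E5. nra. }
  assert (Hs : 0 <= speed t).
  { unfold speed. fold q. apply Rmult_le_pos; [|left; apply Rinv_0_lt_compat; auto].
    apply Rmult_le_pos; [lra|apply sqrt_pos]. }
  assert (Hp : 0 < sqrt (height a b c t ^ 2 + 1)) by (apply sqrt_lt_R0; nra).
  apply Rle_div_l; auto.
  assert (Hp2 : sqrt (height a b c t ^ 2 + 1) ^ 2 = height a b c t ^ 2 + 1) by (apply pow2_sqrt; nra).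
  rewrite <- Hp2, <- Rpow_mult_distr in K2.
  assert (0 <= sqrt (height a b c t ^ 2 + 1) * speed t) by nra.
  destruct (Rle_or_lt (height' a b c t) (speed t * sqrt (height a b c t ^ 2 + 1))); auto. nra.
Qed.

End Curve.

(** Gram-Schmidt: [b] minus its component along [a], divided by the length [sinh d] of the
    result. *)
Definition unit_toward (a b : vec) (d : R) : vec := lin (/ sinh d) b (- cosh d / sinh d) a.

Lemma unit_toward_spec a b d : hyp a -> hyp b -> 0 < d -> bil a b = cosh d ->
  bil a (unit_toward a b d) = 0 /\ bil (unit_toward a b d) (unit_toward a b d) = -1 /\
  bil b (unit_toward a b d) = - sinh d /\
  lin (cosh d) a (sinh d) (unit_toward a b d) = b.
Proof.
  intros [Ha _] [Hb _] Hd E. assert (0 < sinh d) by (apply sinh_gt0; auto).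
  pose proof (cosh_sqr d). unfold unit_toward.
  rewrite !bil_linl, !bil_linr, (bilC b a), Ha, Hb, E.
  repeat split.
  - field; lra.
  - assert (cosh d * cosh d = 1 + sinh d * sinh d) by auto.
    field_simplify; [|lra]. replace (cosh d ^ 2) with (1 + sinh d * sinh d) by (rewrite <- H1; ring). field; lra.
  - field_simplify; [|lra]. replace (cosh d ^ 2) with (1 + sinh d * sinh d) by (rewrite <- H0; ring). field; lra.
  - apply vec_eq; simpl; field; lra.
Qed.

(** The signed distance to the line through [z] orthogonal to the geodesic towards [w] is 0 at [z]
    and [d] at [w], and grows along a curve no faster than its length. *)
Lemma curve_length_ge z w x y : curve z w x y ->
  arcosh (bil (emb z) (emb w)) <= hyp_length x y.
Proof.
  intros (H0 & H1 & H).
  set (d := arcosh (bil (emb z) (emb w))).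
  assert (Hcd : bil (emb z) (emb w) = cosh d)
    by (symmetry; apply cosh_arcosh, bil_hyp_ge1; apply emb_hyp).
  assert (Sp : forall t, 0 <= t <= 1 -> continuous (speed x y) t)
    by (intros t Ht; destruct (H t Ht) as (h1 & h2 & h3 & h4 & h5); now apply continuous_speed).
  assert (ES : ex_RInt (speed x y) 0 1).
  { apply (ex_RInt_continuous (V := R_CompleteNormedModule)). rewrite Rmin_left, Rmax_right by lra. apply Sp. }
  change (d <= RInt (speed x y) 0 1).
  destruct (Rle_lt_or_eq_dec 0 d (arcosh_ge0 _)) as [Hd|Hd].
  (* For [d = 0] there is no direction towards [w]; a non-negative integrand suffices. *)
  2:{ rewrite <- Hd. apply RInt_ge_0; auto; [lra|]. intros t Ht.
      destruct (H t ltac:(lra)) as (h1 & _). unfold speed.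
      apply Rmult_le_pos; [|left; apply Rinv_0_lt_compat; lra].
      apply Rmult_le_pos; [lra|apply sqrt_pos]. }
  destruct (unit_toward_spec _ _ d (emb_hyp z) (emb_hyp w) Hd Hcd) as (U1 & U2 & U3 & _).
  set (U := unit_toward (emb z) (emb w) d) in *.
  set (a := - c0 U). set (b := - c1 U). set (c := - c2 U).
  set (f := fun t => arcsinh (height x y a b c t)).
  set (df := fun t => height' x y a b c t / sqrt (height x y a b c t ^ 2 + 1)).
  assert (Df : forall t, 0 <= t <= 1 -> is_derive f t (df t)).
  { intros t Ht. destruct (H t Ht) as (h1 & h2 & h3 & h4 & h5). unfold f, df.
    apply (is_derive_comp arcsinh (height x y a b c)).
    - apply is_derive_Reals, derivable_pt_lim_arcsinh.
    - now apply is_derive_height. }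
  assert (Cf : forall t, 0 <= t <= 1 -> continuous df t).
  { intros t Ht. destruct (H t Ht) as (h1 & h2 & h3 & h4 & h5). unfold df.
    apply continuity_pt_filterlim. apply continuity_pt_div.
    - apply continuity_pt_filterlim. now apply continuous_height'.
    - apply (continuity_pt_comp (height x y a b c) (fun r => sqrt (r ^ 2 + 1))).
      + apply continuity_pt_filterlim, (ex_derive_continuous (V := R_NormedModule)).
        eexists. now apply is_derive_height.
      + apply (continuity_pt_comp (fun r => r ^ 2 + 1) sqrt).
        * apply derivable_continuous_pt. apply derivable_pt_plus; [apply derivable_pt_pow|apply derivable_pt_const].
        * apply continuity_pt_sqrt. nra.
    - apply Rgt_not_eq, sqrt_lt_R0. nra. }
  assert (I : is_RInt df 0 1 (minus (f 1) (f 0))).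
  { apply (is_RInt_derive f df); rewrite Rmin_left, Rmax_right by lra; auto. }
  assert (V0 : f 0 = 0).
  { unfold f. replace (height x y a b c 0) with (- bil (emb z) U); [rewrite U1, Ropp_0; apply arcsinh_0|].
    pose proof (coord_lt1 z) as L. unfold height, a, b, c, emb, bil. cbn [c0 c1 c2].
    replace (fst (coord z)) with (x 0) in * by (rewrite <- H0; reflexivity).
    replace (snd (coord z)) with (y 0) in * by (rewrite <- H0; reflexivity). field. lra. }
  assert (V1 : f 1 = d).
  { unfold f. replace (height x y a b c 1) with (- bil (emb w) U); [rewrite U3, Ropp_involutive; apply arcsinh_sinh|].
    pose proof (coord_lt1 w) as L. unfold height, a, b, c, emb, bil. cbn [c0 c1 c2].
    replace (fst (coord w)) with (x 1) in * by (rewrite <- H1; reflexivity).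
    replace (snd (coord w)) with (y 1) in * by (rewrite <- H1; reflexivity). field. lra. }
  rewrite V0, V1 in I. replace d with (RInt df 0 1).
  2:{ rewrite (is_RInt_unique _ _ _ _ I). unfold minus, plus, opp; simpl. ring. }
  apply RInt_le; auto; [lra|eexists; exact I|].
  intros t Ht. destruct (H t ltac:(lra)) as (h1 & h2 & h3 & h4 & h5).
  unfold df. apply height'_le_speed; auto.
  unfold a, b, c. unfold bil in U2. lra.
Qed.

(** The norm is immediate. Staying on the upper sheet needs [|u0| < a0], which orthogonality to [a]
    gives by Cauchy-Schwarz ([K1]). *)
Lemma hyp_geodesic a u s : hyp a -> bil a u = 0 -> bil u u = -1 ->
  hyp (lin (cosh s) a (sinh s) u).
Proof.
  intros [Ha Ha0] H1 H2. split.
  - rewrite !bil_linl, !bil_linr, (bilC u a), Ha, H1, H2. pose proof (cosh_sqr s). nra.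
  - simpl. pose proof (cosh_sqr s). pose proof (cosh_pos s). unfold bil in *.
    destruct a as [a0 a1 a2], u as [u0 u1 u2]; simpl in *.
    assert (K0 : (a0 * u0) ^ 2 = (a1 * u1 + a2 * u2) ^ 2) by (f_equal; lra).
    assert (K1 : u0 * u0 <= a0 * a0 - 1).
    { assert (0 <= (a1 * u2 - a2 * u1) ^ 2) by apply pow2_ge_0.
      assert (K2 : (a0 * u0) ^ 2 <= (a1 * a1 + a2 * a2) * (u1 * u1 + u2 * u2)) by nra.
      replace (a1 * a1 + a2 * a2) with (a0 * a0 - 1) in K2 by lra.
      replace (u1 * u1 + u2 * u2) with (1 + u0 * u0) in K2 by lra. nra. }
    assert (K3 : (sinh s * u0) ^ 2 < (cosh s * a0) ^ 2).
    { replace ((sinh s * u0) ^ 2) with ((sinh s * sinh s) * (u0 * u0)) by ring.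
      replace ((cosh s * a0) ^ 2) with ((cosh s * cosh s) * (a0 * a0)) by ring. rewrite H.
      assert (0 <= sinh s * sinh s) by nra. nra. }
    assert (0 < cosh s * a0) by nra. nra.
Qed.

Lemma geodesic_curve z w :
  exists x y, curve z w x y /\ hyp_length x y = arcosh (bil (emb z) (emb w)).
Proof.
  set (d := arcosh (bil (emb z) (emb w))).
  assert (Hcd : bil (emb z) (emb w) = cosh d)
    by (symmetry; apply cosh_arcosh, bil_hyp_ge1; apply emb_hyp).
  destruct (Rle_lt_or_eq_dec 0 d (arcosh_ge0 _)) as [Hd|Hd].
  2:{ rewrite <- Hd, cosh_0 in Hcd. apply hyp_eq in Hcd; try apply emb_hyp. apply emb_inj in Hcd. subst w.
      exists (fun _ => fst (coord z)), (fun _ => snd (coord z)). split.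
      - split; [|split]; [now rewrite <- surjective_pairing..|]. intros t _.
        pose proof (coord_lt1 z). repeat split.
        + simpl. nra.
        + apply ex_derive_const.
        + apply ex_derive_const.
        + apply continuous_ext with (fun _ => 0); [intros; now rewrite Derive_const|apply continuous_const].
        + apply continuous_ext with (fun _ => 0); [intros; now rewrite Derive_const|apply continuous_const].
      - rewrite <- Hd. unfold hyp_length. rewrite RInt_ext with (g := fun _ => 0).
        + rewrite RInt_const. unfold scal; simpl; unfold mult; simpl. ring.
        + intros t _. rewrite !Derive_const. replace (0 ^ 2 + 0 ^ 2) with 0 by ring. rewrite sqrt_0. unfold Rdiv. now rewrite Rmult_0_r, Rmult_0_l. }
  destruct (unit_toward_spec _ _ d (emb_hyp z) (emb_hyp w) Hd Hcd) as (U1 & U2 & _ & U4).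
  set (U := unit_toward (emb z) (emb w) d) in *. set (A := emb z) in *.
  assert (HA : hyp A) by apply emb_hyp. assert (HAz : A = emb z) by reflexivity.
  clearbody U. clearbody d. clearbody A.
  (* The geodesic at constant speed [d]; its velocity is [d] times [V]. *)
  pose (X := fun t => lin (cosh (t * d)) A (sinh (t * d)) U).
  pose (V := fun t => lin (sinh (t * d)) A (cosh (t * d)) U).
  assert (HX : forall t, hyp (X t)) by (intros; now apply hyp_geodesic).
  assert (XV : forall t, bil (X t) (V t) = 0).
  { intros t. unfold X, V. rewrite !bil_linl, !bil_linr, (bilC U A), U1, U2, (proj1 HA). ring. }
  assert (VV : forall t, bil (V t) (V t) = -1).
  { intros t. unfold V. rewrite !bil_linl, !bil_linr, (bilC U A), U1, U2, (proj1 HA). pose proof (cosh_sqr (t * d)). nra. }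
  assert (D0 : forall t, is_derive (fun s => c0 (X s)) t (d * c0 (V t))).
  { intros t. unfold X, V; simpl. unfold cosh, sinh. auto_derive; auto. field. }
  assert (D1 : forall t, is_derive (fun s => c1 (X s)) t (d * c1 (V t))).
  { intros t. unfold X, V; simpl. unfold cosh, sinh. auto_derive; auto. field. }
  assert (D2 : forall t, is_derive (fun s => c2 (X s)) t (d * c2 (V t))).
  { intros t. unfold X, V; simpl. unfold cosh, sinh. auto_derive; auto. field. }
  (* Quotient rule for [f / (1 + e)] when [e' = d * p] and [f' = d * q]. *)
  pose (dq := fun (e f p q : R) => d * ((1 + e) * q - f * p) / (1 + e) ^ 2).
  assert (P0 : forall t, 0 < 1 + c0 (X t)) by (intros t; destruct (HX t); lra).
  assert (E1 : forall t, is_derive (fun s => c1 (X s) / (1 + c0 (X s))) t (dq (c0 (X t)) (c1 (X t)) (c0 (V t)) (c1 (V t)))).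
  { intros t. specialize (P0 t). evar_last. apply is_derive_div; [apply D1| |].
    - apply (is_derive_plus (fun _ => 1) (fun s => c0 (X s))); [apply is_derive_const|apply D0].
    - change (1 + c0 (X t) <> 0). lra.
    - cbv beta. change (plus zero (d * c0 (V t))) with (0 + d * c0 (V t)). unfold dq. field. lra. }
  assert (E2 : forall t, is_derive (fun s => c2 (X s) / (1 + c0 (X s))) t (dq (c0 (X t)) (c2 (X t)) (c0 (V t)) (c2 (V t)))).
  { intros t. specialize (P0 t). evar_last. apply is_derive_div; [apply D2| |].
    - apply (is_derive_plus (fun _ => 1) (fun s => c0 (X s))); [apply is_derive_const|apply D0].
    - change (1 + c0 (X t) <> 0). lra.
    - cbv beta. change (plus zero (d * c0 (V t))) with (0 + d * c0 (V t)). unfold dq. field. lra. }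
  assert (CX : forall f t l, is_derive f t l -> continuity_pt f t).
  { intros f t l Hf. apply continuity_pt_filterlim, (ex_derive_continuous (V := R_NormedModule)). now exists l. }
  assert (CV0 : forall t, continuity_pt (fun s => c0 (V s)) t).
  { intros t. apply CX with (d * c0 (X t)). unfold X, V; simpl; unfold cosh, sinh. auto_derive; auto. field. }
  assert (CV1 : forall t, continuity_pt (fun s => c1 (V s)) t).
  { intros t. apply CX with (d * c1 (X t)). unfold X, V; simpl; unfold cosh, sinh. auto_derive; auto. field. }
  assert (CV2 : forall t, continuity_pt (fun s => c2 (V s)) t).
  { intros t. apply CX with (d * c2 (X t)). unfold X, V; simpl; unfold cosh, sinh. auto_derive; auto. field. }
  assert (CX0 : forall t, continuity_pt (fun s => c0 (X s)) t) by (intros t; eapply CX, D0).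
  assert (CX1 : forall t, continuity_pt (fun s => c1 (X s)) t) by (intros t; eapply CX, D1).
  assert (CX2 : forall t, continuity_pt (fun s => c2 (X s)) t) by (intros t; eapply CX, D2).
  exists (fun s => c1 (X s) / (1 + c0 (X s))), (fun s => c2 (X s) / (1 + c0 (X s))).
  assert (Lt : forall t, (c1 (X t) / (1 + c0 (X t))) ^ 2 + (c2 (X t) / (1 + c0 (X t))) ^ 2 = 1 - 2 / (1 + c0 (X t))).
  { intros t. specialize (P0 t). destruct (HX t) as [h _]. unfold bil in h.
    replace ((c1 (X t) / (1 + c0 (X t))) ^ 2 + (c2 (X t) / (1 + c0 (X t))) ^ 2)
      with ((c1 (X t) * c1 (X t) + c2 (X t) * c2 (X t)) / (1 + c0 (X t)) ^ 2) by (field; lra).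
    replace (c1 (X t) * c1 (X t) + c2 (X t) * c2 (X t)) with ((c0 (X t) - 1) * (1 + c0 (X t))) by lra.
    field; lra. }
  split.
  - split; [|split].
    + assert (E : X 0 = A). { unfold X. rewrite Rmult_0_l, cosh_0, sinh_0. apply vec_eq; simpl; ring. }
      rewrite E, HAz. symmetry. apply emb_coord.
    + assert (E : X 1 = emb w). { unfold X. rewrite Rmult_1_l. exact U4. }
      rewrite E. symmetry. apply emb_coord.
    + intros t _. repeat split.
      * rewrite Lt. specialize (P0 t). assert (0 < 2 / (1 + c0 (X t))) by (apply Rdiv_lt_0_compat; lra). lra.
      * eexists; apply E1.
      * eexists; apply E2.
      * apply continuous_ext with (fun t => dq (c0 (X t)) (c1 (X t)) (c0 (V t)) (c1 (V t))).
        { intros s. symmetry. apply is_derive_unique, E1. }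
        apply continuity_pt_filterlim. unfold dq. specialize (P0 t).
        cont_pt; first [exact (CV0 t) | exact (CV1 t) | exact (CX0 t) | exact (CX1 t)
                       | apply pow_nonzero; lra].
      * apply continuous_ext with (fun t => dq (c0 (X t)) (c2 (X t)) (c0 (V t)) (c2 (V t))).
        { intros s. symmetry. apply is_derive_unique, E2. }
        apply continuity_pt_filterlim. unfold dq. specialize (P0 t).
        cont_pt; first [exact (CV0 t) | exact (CV2 t) | exact (CX0 t) | exact (CX2 t)
                       | apply pow_nonzero; lra].
  - unfold hyp_length. rewrite RInt_ext with (g := fun _ => d).
    + rewrite RInt_const. unfold scal; simpl; unfold mult; simpl. ring.
    + intros t _. match goal with |- ?a = ?b => change (@eq R a b) end.
      assert (F1 : Derive (fun s : R => c1 (X s) / (1 + c0 (X s))) t =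
        dq (c0 (X t)) (c1 (X t)) (c0 (V t)) (c1 (V t))) by (apply is_derive_unique, E1).
      assert (F2 : Derive (fun s : R => c2 (X s) / (1 + c0 (X s))) t =
        dq (c0 (X t)) (c2 (X t)) (c0 (V t)) (c2 (V t))) by (apply is_derive_unique, E2).
      rewrite F1, F2, Lt.
      specialize (P0 t).
      replace (1 - (1 - 2 / (1 + c0 (X t)))) with (2 / (1 + c0 (X t))) by ring.
      replace (dq (c0 (X t)) (c1 (X t)) (c0 (V t)) (c1 (V t)) ^ 2 + dq (c0 (X t)) (c2 (X t)) (c0 (V t)) (c2 (V t)) ^ 2)
        with ((d / (1 + c0 (X t))) ^ 2).
      * rewrite sqrt_pow2; [field; lra|]. apply Rlt_le, Rdiv_lt_0_compat; lra.
      * destruct (HX t) as [h _]. specialize (XV t). specialize (VV t). unfold bil in *. unfold dq.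
        destruct (X t) as [e f g], (V t) as [p q r]; cbn [c0 c1 c2] in *.
        (* Stereographic projection is conformal: it divides lengths by [1 + e], and the density
           [2 / (1 - |z|^2) = 1 + e] restores them. *)
        assert (K : ((1 + e) * q - f * p) ^ 2 + ((1 + e) * r - g * p) ^ 2 = (1 + e) ^ 2).
        { replace (((1 + e) * q - f * p) ^ 2 + ((1 + e) * r - g * p) ^ 2)
            with ((1+e)^2*(q*q+r*r) - 2 * (1+e)*p*(f*q+g*r)+ p*p*(f*f+g*g)) by ring.
          replace (q*q+r*r) with (1+p*p) by lra. replace (f*q+g*r) with (e*p) by lra.
          replace (f*f+g*g) with (e*e-1) by lra. ring. }
        replace ((d * ((1 + e) * q - f * p) / (1 + e) ^ 2)^2 + (d * ((1 + e) * r - g * p) / (1 + e) ^ 2)^2)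
          with (d ^ 2 * (((1 + e) * q - f * p) ^ 2 + ((1 + e) * r - g * p) ^ 2) / (1+e)^4) by (field; lra).
        rewrite K. field; lra.
Qed.

Lemma delta_arcosh z w : delta z w = arcosh (bil (emb z) (emb w)).
Proof.
  unfold delta. rewrite (is_glb_Rbar_unique _ (Finite (arcosh (bil (emb z) (emb w))))); [reflexivity|].
  split.
  - intros l (x & y & H & ->). now apply curve_length_ge.
  - intros b Hb. destruct (geodesic_curve z w) as (x & y & H & E).
    apply Hb. exists x, y. now rewrite E.
Qed.

Lemma cosh_delta z w : cosh (delta z w) = bil (emb z) (emb w).
Proof. rewrite delta_arcosh. apply cosh_arcosh, bil_hyp_ge1; apply emb_hyp. Qed.

Lemma delta_ge0 z w : 0 <= delta z w.
Proof. rewrite delta_arcosh. apply arcosh_ge0. Qed.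

Lemma deltaC z w : delta z w = delta w z.
Proof. now rewrite !delta_arcosh, bilC. Qed.

Lemma delta_refl z : delta z z = 0.
Proof.
  apply cosh_inj; [apply delta_ge0|lra|]. rewrite cosh_delta, cosh_0. apply emb_hyp.
Qed.

Lemma delta_eq0 z w : delta z w = 0 -> z = w.
Proof.
  intros H. apply emb_inj, hyp_eq; try apply emb_hyp. now rewrite <- cosh_delta, H, cosh_0.
Qed.

Lemma delta_gt0 z w : z <> w -> 0 < delta z w.
Proof. intros H. destruct (delta_ge0 z w) as [|E]; auto. exfalso; apply H, delta_eq0; auto. Qed.

(** Concatenated curves may have a corner, so the distance formula is used instead: the Gram
    determinant bounds [|r - p * q|] by [s * t], and the addition formula for [cosh] concludes. *)
Lemma delta_triangle x y z : delta x z <= delta x y + delta y z.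
Proof.
  pose proof (delta_ge0 x y) as H1. pose proof (delta_ge0 y z) as H2.
  apply cosh_le_inv; [lra|]. rewrite cosh_add.
  pose proof (cosh_sqr (delta x y)). pose proof (cosh_sqr (delta y z)).
  apply sinh_ge0 in H1. apply sinh_ge0 in H2.
  pose proof (gram (emb x) (emb y) (emb z)) as K.
  rewrite !(proj1 (emb_hyp _)), <- !cosh_delta in K.
  set (p := cosh (delta x y)) in *. set (q := cosh (delta y z)) in *. set (r := cosh (delta x z)) in *.
  set (s := sinh (delta x y)) in *. set (t := sinh (delta y z)) in *.
  assert ((r - p * q) ^ 2 <= (s * t) ^ 2).
  { replace ((s * t) ^ 2) with ((s*s)*(t*t)) by ring. replace (s*s) with (p*p-1) by lra.
    replace (t*t) with (q*q-1) by lra. nra. }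
  assert (0 <= s * t) by nra. nra.
Qed.

(** With the image written as [n / m], the quantity [|m|^2 - |n|^2] equals [1 - |z|^2]. The lifted
    image is then quadratic in [n] and [m], over the same denominator as the lift of the point. *)
Lemma delta_PSU11 g z w : PSU11 g -> delta (g z) (g w) = delta z w.
Proof.
  intros (a & b & Hab & Hg). rewrite !delta_arcosh. f_equal.
  destruct a as [a1 a2], b as [b1 b2].
  assert (Hab' : a1*a1 + a2*a2 - b1*b1 - b2*b2 = 1).
  { unfold Cmod in Hab; cbn [fst snd] in Hab. rewrite !pow2_sqrt in Hab by nra. lra. }
  assert (F : forall z, let x := fst (coord z) in let y := snd (coord z) in
     let n1 := a1*x - a2*y + b1 in let n2 := a1*y+a2*x+b2 in
     let m1 := b1*x+b2*y+a1 in let m2 := b1*y-b2*x-a2 in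
     let q := 1 - (x*x+y*y) in
     m1*m1+m2*m2 - (n1*n1+n2*n2) = q /\ 0 < m1*m1+m2*m2 /\
     emb (g z) = Vec ((m1*m1+m2*m2 + (n1*n1+n2*n2))/q) (2*(n1*m1+n2*m2)/q) (2*(n2*m1-n1*m2)/q)).
  { intros u x y n1 n2 m1 m2 q. pose proof (coord_lt1 u) as L. fold x y in L.
    assert (M : m1*m1+m2*m2 - (n1*n1+n2*n2) = q).
    { unfold m1, m2, n1, n2, q. replace (1 - (x*x+y*y)) with ((a1*a1 + a2*a2 - b1*b1 - b2*b2) * (1 - (x*x+y*y))) by (rewrite Hab'; ring). ring. }
    assert (M1 : 0 < m1*m1+m2*m2) by (unfold q in M; nra).
    split; [exact M|split; [exact M1|]].
    assert (E : coord (g u) = ((n1*m1+n2*m2)/(m1*m1+m2*m2), (n2*m1-n1*m2)/(m1*m1+m2*m2))).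
    { rewrite Hg. rewrite (surjective_pairing (coord u)). fold x y.
      unfold Cdiv, Cmult, Cplus, Cinv, Cconj; simpl.
      replace (b1 * x - - b2 * y + a1) with m1 by (unfold m1; ring).
      replace (b1 * y + - b2 * x + - a2) with m2 by (unfold m2; ring).
      replace (a1 * x - a2 * y + b1) with n1 by (unfold n1; ring).
      replace (a1 * y + a2 * x + b2) with n2 by (unfold n2; ring).
      f_equal; field; lra. }
    unfold emb. rewrite E. cbn [fst snd].
    set (M2 := m1*m1+m2*m2) in *.
    assert (Q : (n1 * m1 + n2 * m2) / M2 * ((n1 * m1 + n2 * m2) / M2) + (n2 * m1 - n1 * m2) / M2 * ((n2 * m1 - n1 * m2) / M2) = (n1*n1+n2*n2)/M2).
    { unfold M2. field. fold M2. lra. }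
    assert (Hq : 0 < q) by (unfold q; lra).
    rewrite Q. replace (1 - (n1*n1+n2*n2)/M2) with (q / M2) by (rewrite <- M; field; lra).
    f_equal; field; lra. }
  destruct (F z) as (F1 & F2 & F3). destruct (F w) as (G1 & G2 & G3). rewrite F3, G3. clear F F3 G3.
  pose proof (coord_lt1 z) as L1. pose proof (coord_lt1 w) as L2.
  unfold bil, emb. cbn [c0 c1 c2] in *.
  set (x := fst (coord z)) in *. set (y := snd (coord z)) in *.
  set (x' := fst (coord w)) in *. set (y' := snd (coord w)) in *.
  assert (Hq1 : 1 - (x*x+y*y) <> 0) by lra. assert (Hq2 : 1 - (x'*x'+y'*y') <> 0) by lra.
  clear F1 F2 G1 G2.
  apply Rmult_eq_reg_r with ((1 - (x*x+y*y)) * (1 - (x'*x'+y'*y'))); [|apply Rmult_integral_contrapositive_currified; auto].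
  field_simplify; auto.
  apply Rminus_diag_uniq.
  (* The Lorentz product is multiplied by the square of [|a|^2 - |b|^2]. *)
  transitivity (((a1*a1 + a2*a2 - b1*b1 - b2*b2)^2 - 1) * ((1 + (x*x+y*y)) * (1 + (x'*x'+y'*y')) - 4*x*x' - 4*y*y')).
  - ring.
  - rewrite Hab'. ring.
Qed.

(** * Geodesics, segments and convex sets *)

Ltac vec_ext := apply vec_eq; unfold lin; cbn [c0 c1 c2].

Definition tangent (a : H2) (u : vec) : Prop := bil (emb a) u = 0 /\ bil u u = -1.

Definition geod (a : H2) (u : vec) (s : R) : H2 :=
  unemb (lin (cosh s) (emb a) (sinh s) u).

Definition dir (a b : H2) : vec := unit_toward (emb a) (emb b) (delta a b).

Lemma emb_geod a u s : tangent a u -> emb (geod a u s) = lin (cosh s) (emb a) (sinh s) u.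
Proof. intros [H1 H2]. apply emb_unemb, hyp_geodesic; auto. apply emb_hyp. Qed.

Lemma bil_emb_refl a : bil (emb a) (emb a) = 1.
Proof. apply emb_hyp. Qed.

Lemma delta_geod a u s t : tangent a u -> delta (geod a u s) (geod a u t) = Rabs (s - t).
Proof.
  intros H. apply cosh_inj; [apply delta_ge0|apply Rabs_pos|].
  rewrite cosh_delta, cosh_abs, cosh_sub, !emb_geod by auto.
  rewrite !bil_linl, !bil_linr, (bilC u), bil_emb_refl, (proj1 H), (proj2 H). ring.
Qed.

Lemma geod_0 a u : geod a u 0 = a.
Proof.
  unfold geod. rewrite cosh_0, sinh_0. rewrite <- (unemb_emb a) at 2. f_equal.
  vec_ext; ring.
Qed.

Lemma delta_geod0 a u s : tangent a u -> 0 <= s -> delta a (geod a u s) = s.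
Proof.
  intros H Hs. rewrite <- (geod_0 a u) at 1. rewrite delta_geod; auto.
  rewrite Rabs_left1; lra.
Qed.

Lemma tangent_dir a b : a <> b -> tangent a (dir a b).
Proof.
  intros H. apply delta_gt0 in H.
  destruct (unit_toward_spec (emb a) (emb b) (delta a b)) as (H1 & H2 & _ & _); auto;
    try apply emb_hyp. symmetry; apply cosh_delta. now split.
Qed.

Lemma geod_dir_end a b : a <> b -> geod a (dir a b) (delta a b) = b.
Proof.
  intros H. apply delta_gt0 in H.
  destruct (unit_toward_spec (emb a) (emb b) (delta a b)) as (_ & _ & _ & H4); auto;
    try apply emb_hyp. symmetry; apply cosh_delta.
  unfold geod, dir. rewrite H4. apply unemb_emb.
Qed.

(** Hyperbolic form of spherical linear interpolation; the coefficients are both non-negative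
    exactly between the end-points. *)
Lemma emb_geod_dir a b s : a <> b ->
  emb (geod a (dir a b) s) =
  lin (sinh (delta a b - s) / sinh (delta a b)) (emb a) (sinh s / sinh (delta a b)) (emb b).
Proof.
  intros H. rewrite emb_geod by now apply tangent_dir.
  apply delta_gt0 in H. apply sinh_gt0 in H. rewrite sinh_sub. unfold dir, unit_toward.
  vec_ext; field; lra.
Qed.

Lemma segmentC a b x : segment a b x <-> segment b a x.
Proof. unfold segment. rewrite (deltaC a b), (deltaC a x), (deltaC x b). split; lra. Qed.

Lemma segment_left a b : segment a b a.
Proof. unfold segment. rewrite delta_refl. ring. Qed.

Lemma segment_right a b : segment a b b.
Proof. unfold segment. rewrite delta_refl. ring. Qed.

(** Uniqueness of geodesics: the distances of [x] to [a] and [b] fix its Lorentz product with the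
    candidate point, and this product is 1. *)
Lemma segment_geod_dir a b x : a <> b -> segment a b x -> x = geod a (dir a b) (delta a x).
Proof.
  intros H S. symmetry. pose proof (delta_gt0 _ _ H) as Hd. apply sinh_gt0 in Hd.
  apply emb_inj, hyp_eq; try apply emb_hyp.
  rewrite emb_geod_dir, bil_linl, <- !cosh_delta by auto.
  rewrite (deltaC b x). unfold segment in S. rewrite <- S in *.
  replace (delta a x + delta x b - delta a x) with (delta x b) by ring.
  rewrite sinh_add in *. field. lra.
Qed.

Lemma segment_of_geod a u r s t : tangent a u -> r <= s <= t ->
  segment (geod a u r) (geod a u t) (geod a u s).
Proof.
  intros H Hs. unfold segment. rewrite !delta_geod by auto.
  rewrite !Rabs_left1; lra.
Qed.

Lemma segment_geod_dir_in a b s : a <> b -> 0 <= s <= delta a b -> segment a b (geod a (dir a b) s).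
Proof.
  intros H Hs. pose proof (segment_of_geod a (dir a b) 0 s (delta a b) (tangent_dir a b H) Hs) as K.
  now rewrite geod_0, geod_dir_end in K.
Qed.

Lemma segment_refl_eq a x : segment a a x -> x = a.
Proof.
  unfold segment. rewrite delta_refl, (deltaC x a). pose proof (delta_ge0 a x). intros.
  symmetry; apply delta_eq0; lra.
Qed.

Lemma segment_lin a b x : segment a b x ->
  exists s t, 0 <= s /\ 0 <= t /\ emb x = lin s (emb a) t (emb b).
Proof.
  intros S. destruct (classic (a = b)) as [<-|H].
  - apply segment_refl_eq in S. subst x. exists 1, 0. repeat split; try lra. vec_ext; ring.
  - pose proof (segment_geod_dir _ _ _ H S) as E. pose proof (delta_gt0 _ _ H) as Hd.
    apply sinh_gt0 in Hd. rewrite E, emb_geod_dir by auto.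
    do 2 eexists; split; [|split; [|reflexivity]];
      apply Rmult_le_pos; try (left; apply Rinv_0_lt_compat; auto; fail); apply sinh_ge0.
    + unfold segment in S. pose proof (delta_ge0 x b). lra.
    + apply delta_ge0.
Qed.

(** With [segment_lin] this identifies the segment with the part of the hyperboloid in the cone
    spanned by [a] and [b]. *)
Lemma lin_segment a b x s t : 0 <= s -> 0 <= t -> emb x = lin s (emb a) t (emb b) -> segment a b x.
Proof.
  intros Hs Ht E. set (d := delta a b). pose proof (cosh_sqr d) as Cd.
  assert (Hd : 0 <= sinh d) by apply sinh_ge0, delta_ge0.
  assert (N : s * s + t * t + 2 * s * t * cosh d = 1).
  { pose proof (bil_emb_refl x) as K. rewrite E, !bil_linl, !bil_linr, !bil_emb_refl, (bilC (emb b)), <- cosh_delta in K.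
    unfold d. lra. }
  pose proof (cosh_pos d) as Pd.
  (* The prospective distance from [a], read off from the coefficient [t = sinh r / sinh d]. *)
  set (r := arcsinh (t * sinh d)).
  assert (S1 : sinh r = t * sinh d) by apply sinh_arcsinh.
  assert (Hr : 0 <= r) by (apply arcsinh_ge0; nra).
  assert (C1 : cosh r = s + t * cosh d).
  { pose proof (cosh_sqr r) as K. rewrite S1 in K. pose proof (cosh_pos r).
    assert (cosh r * cosh r = (s + t * cosh d) * (s + t * cosh d)) by nra.
    assert (0 <= s + t * cosh d) by nra. nra. }
  assert (E1 : delta a x = r).
  { apply cosh_inj; [apply delta_ge0|auto|].
    rewrite cosh_delta, E, bil_linr, bil_emb_refl, <- cosh_delta. fold d. lra. }
  assert (Hrd : r <= d).
  { assert (0 <= sinh (d - r)) by (rewrite sinh_sub, C1, S1; nra).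
    rewrite <- sinh_0 in H. apply sinh_le_inv in H. lra. }
  assert (E2 : delta x b = d - r).
  { apply cosh_inj; [apply delta_ge0|lra|].
    rewrite cosh_delta, E, bil_linl, bil_emb_refl, <- cosh_delta, cosh_sub, C1, S1. fold d. nra. }
  unfold segment. fold d. lra.
Qed.

Lemma convex_segment a b : convex (segment a b).
Proof.
  intros x y z Hx Hy Hz.
  destruct (segment_lin _ _ _ Hx) as (s & t & h1 & h2 & E1).
  destruct (segment_lin _ _ _ Hy) as (s' & t' & h3 & h4 & E2).
  destruct (segment_lin _ _ _ Hz) as (p & q & h5 & h6 & E3).
  apply lin_segment with (p * s + q * s') (p * t + q * t'); try nra.
  rewrite E3, E1, E2. vec_ext; ring.
Qed.

Lemma convex_lin3 (A : H2 -> Prop) a b x w p q r : convex A -> A a -> A b -> A x ->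
  0 <= p -> 0 <= q -> 0 <= r -> emb w = lin 1 (lin p (emb a) q (emb b)) r (emb x) -> A w.
Proof.
  intros HA Ha Hb Hx Hp Hq Hr E.
  destruct (Rle_lt_or_eq_dec 0 (p + q) ltac:(lra)) as [H|H].
  (* Normalising the part spanned by [a] and [b] gives a point of the segment [a b], and [w] lies
     between it and [x]. *)
  - set (N2 := p * p + q * q + 2 * p * q * bil (emb a) (emb b)).
    pose proof (bil_hyp_ge1 (emb a) (emb b) (emb_hyp a) (emb_hyp b)) as K.
    assert (HN : 0 < N2).
    { assert (0 <= p * q) by now apply Rmult_le_pos.
      assert (p * q <= p * q * bil (emb a) (emb b)) by nra.
      assert (0 < (p + q) * (p + q)) by now apply Rmult_lt_0_compat. unfold N2. nra. }
    set (N := sqrt N2). assert (NP : 0 < N) by (apply sqrt_lt_R0; auto).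
    assert (NN : N * N = N2) by (apply sqrt_sqrt; lra). clearbody N.
    assert (Hy : hyp (lin (p / N) (emb a) (q / N) (emb b))).
    { split.
      - rewrite !bil_linl, !bil_linr, !bil_emb_refl, (bilC (emb b)).
        transitivity (N2 / (N * N)); [unfold N2; field; lra|]. rewrite NN. field. lra.
      - destruct (emb_hyp a), (emb_hyp b). unfold lin; cbn [c0].
        replace (p / N * c0 (emb a) + q / N * c0 (emb b)) with ((p * c0 (emb a) + q * c0 (emb b)) / N) by (field; lra).
        apply Rdiv_lt_0_compat; auto.
        destruct (Rle_lt_or_eq_dec 0 p Hp) as [Hp'|Hp']; [|assert (0 < q) by lra]; nra. }
    apply (HA (unemb (lin (p / N) (emb a) (q / N) (emb b))) x); auto.
    + apply (HA a b); auto. apply lin_segment with (p / N) (q / N).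
      * apply Rmult_le_pos; auto. left; now apply Rinv_0_lt_compat.
      * apply Rmult_le_pos; auto. left; now apply Rinv_0_lt_compat.
      * now apply emb_unemb.
    + apply lin_segment with N r; try lra. rewrite emb_unemb, E by auto.
      vec_ext; field; lra.
  - apply (HA a x); auto. apply lin_segment with 0 r; try lra. rewrite E.
    assert (p = 0) by lra. assert (q = 0) by lra. subst. vec_ext; ring.
Qed.

(* By the Gram determinant, [N . w] differs from [cosh (delta c w) * (N . c)] by at most
   a multiple of [sinh (delta c w)] depending only on [N] and [c]. *)
Lemma halfplane_open (N : vec) (c : H2) : 0 < bil N (emb c) ->
  exists e, 0 < e /\ forall w, delta c w < e -> 0 < bil N (emb w).
Proof.
  intros H. set (S := bil N (emb c)) in *. set (K := Rabs (S * S - bil N N)).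
  pose proof (Rabs_pos (S * S - bil N N)) as HK. fold K in HK.
  assert (HK2 : S * S - bil N N <= K) by apply Rle_abs.
  exists (arcsinh (S / (1 + K))). split; [apply arcsinh_gt0, Rdiv_lt_0_compat; lra|].
  intros w Hw. apply sinh_lt in Hw. rewrite sinh_arcsinh in Hw.
  assert (Hs := sinh_ge0 _ (delta_ge0 c w)).
  assert (C1 := cosh_sqr (delta c w)). assert (C2 := cosh_ge1 (delta c w)).
  rewrite cosh_delta in C1, C2. set (s := sinh (delta c w)) in *.
  pose proof (gram (emb c) N (emb w)) as G. rewrite !bil_emb_refl, (bilC (emb c) N) in G. fold S in G.
  set (p := bil (emb c) (emb w)) in *. set (r := bil N (emb w)) in *.
  assert (G2 : (r - S * p) ^ 2 <= (s * s) * K).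
  { assert (0 <= s * s) by nra. assert ((r - S * p) ^ 2 <= (s * s) * (S * S - bil N N)) by nra. nra. }
  assert (Hs1 : s * (1 + K) < S) by (apply Rlt_div_r; lra).
  destruct (Rlt_or_le 0 r) as [|Hr]; auto. exfalso.
  assert (S <= S * p - r) by nra.
  assert (S * S <= (r - S * p) ^ 2) by (replace ((r - S * p) ^ 2) with ((S * p - r) * (S * p - r)) by ring; nra).
  assert (S * S <= s * s * K) by lra.
  assert (0 <= s * (1 + K)) by (apply Rmult_le_pos; lra).
  assert ((s * (1 + K)) * (s * (1 + K)) < S * S) by nra.
  assert (s * s * K <= (s * (1 + K)) * (s * (1 + K))).
  { replace ((s * (1 + K)) * (s * (1 + K))) with (s * s * (1 + 2 * K + K * K)) by ring.
    apply Rmult_le_compat_l; nra. }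
  lra.
Qed.

(** Cramer's rule: up to a common factor, the coordinates of [w] in the basis [a, b, x]. *)
Lemma cramer a b x w :
  lin (bil (cross a b) x) w 0 w =
  lin 1 (lin (bil (cross b x) w) a (bil (cross x a) w) b) (bil (cross a b) w) x.
Proof. apply vec_eq; unfold bil, cross, lin; cbn [c0 c1 c2]; ring. Qed.

Lemma ball_trans a b e w : delta a b < e -> delta b w < e - delta a b -> delta a w < e.
Proof. pose proof (delta_triangle a b w). lra. Qed.

(** In the basis [a, b, x] the first two coordinates are positive at [c], hence near it; the third
    is non-negative on the side of [x]. So the cone over the triangle contains a half-disk around
    [c]. *)
Lemma half_disk_pos (A : H2 -> Prop) a b x c s t : convex A -> A a -> A b -> A x ->
  0 < s -> 0 < t -> emb c = lin s (emb a) t (emb b) -> 0 < bil (cross (emb a) (emb b)) (emb x) ->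
  exists e, 0 < e /\ forall w, delta c w < e -> 0 <= bil (cross (emb a) (emb b)) (emb w) -> A w.
Proof.
  intros HA Ha Hb Hx Hs Ht E HD. set (D := bil (cross (emb a) (emb b)) (emb x)) in *.
  destruct (halfplane_open (cross (emb b) (emb x)) c) as (e1 & He1 & H1).
  { rewrite E, bil_linr, bil_cross_l, bil_cross_rot. fold D. nra. }
  destruct (halfplane_open (cross (emb x) (emb a)) c) as (e2 & He2 & H2).
  { rewrite E, bil_linr, bil_cross_r, <- bil_cross_rot. fold D. nra. }
  exists (Rmin e1 e2). split; [now apply Rmin_pos|]. intros w Hw Hw0.
  assert (K1 := H1 w (Rlt_le_trans _ _ _ Hw (Rmin_l _ _))).
  assert (K2 := H2 w (Rlt_le_trans _ _ _ Hw (Rmin_r _ _))).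
  pose proof (cramer (emb a) (emb b) (emb x) (emb w)) as K. fold D in K.
  assert (ID : 0 < / D) by now apply Rinv_0_lt_compat.
  apply (convex_lin3 A a b x w (/ D * bil (cross (emb b) (emb x)) (emb w))
    (/ D * bil (cross (emb x) (emb a)) (emb w)) (/ D * bil (cross (emb a) (emb b)) (emb w))); auto; try nra.
  set (k1 := bil (cross (emb b) (emb x)) (emb w)) in *. set (k2 := bil (cross (emb x) (emb a)) (emb w)) in *.
  set (k3 := bil (cross (emb a) (emb b)) (emb w)) in *.
  pose proof (f_equal c0 K) as Q0. pose proof (f_equal c1 K) as Q1. pose proof (f_equal c2 K) as Q2.
  unfold lin in Q0, Q1, Q2. cbn [c0 c1 c2] in Q0, Q1, Q2.
  vec_ext; apply Rmult_eq_reg_l with D; try lra; field_simplify; lra.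
Qed.

Lemma half_disk (A : H2 -> Prop) a b x c s t : convex A -> A a -> A b -> A x ->
  0 < s -> 0 < t -> emb c = lin s (emb a) t (emb b) -> bil (cross (emb a) (emb b)) (emb x) <> 0 ->
  exists e, 0 < e /\ forall w, delta c w < e ->
    0 <= bil (cross (emb a) (emb b)) (emb x) * bil (cross (emb a) (emb b)) (emb w) -> A w.
Proof.
  intros HA Ha Hb Hx Hs Ht E HD.
  destruct (Rlt_or_le 0 (bil (cross (emb a) (emb b)) (emb x))) as [H|H].
  - destruct (half_disk_pos A a b x c s t) as (e & He & K); auto.
    exists e; split; auto. intros w Hw Hw0. apply K; auto. nra.
  - destruct (half_disk_pos A b a x c t s) as (e & He & K); auto.
    + rewrite E. vec_ext; ring.
    + rewrite bil_cross_swap. lra.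
    + exists e; split; auto. intros w Hw Hw0. apply K; auto. rewrite bil_cross_swap. nra.
Qed.

(** Leaves [z] at right angles to the line; [bil N N < 0] makes [N] the normal of a line. *)
Lemma ball_off_line (N : vec) (z : H2) e : bil N (emb z) = 0 -> bil N N < 0 -> 0 < e ->
  (exists w, delta z w < e /\ 0 < bil N (emb w)) /\ (exists w, delta z w < e /\ bil N (emb w) < 0).
Proof.
  intros H0 HN He. set (k := sqrt (- bil N N)).
  assert (Hk : 0 < k) by (apply sqrt_lt_R0; lra). assert (Hkk : k * k = - bil N N) by (apply sqrt_sqrt; lra).
  assert (T : forall sg, sg * sg = 1 -> tangent z (lin (sg / k) N 0 N)).
  { intros sg Hsg. split.
    - rewrite bil_linr, (bilC _ N), H0. ring.
    - rewrite bil_linl, !bil_linr. replace (bil N N) with (- (k * k)) by lra.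
      transitivity (- (sg * sg)); [field; lra|lra]. }
  assert (V : forall sg, sg * sg = 1 -> bil N (emb (geod z (lin (sg / k) N 0 N) (e / 2))) = - sg * k * sinh (e / 2)).
  { intros sg Hsg. rewrite emb_geod, bil_linr, H0, bil_linr by auto. replace (bil N N) with (- (k * k)) by lra. field. lra. }
  assert (0 < sinh (e / 2)) by (apply sinh_gt0; lra).
  split.
  - exists (geod z (lin (-1 / k) N 0 N) (e / 2)). rewrite delta_geod0, V by (try apply T; lra). split; nra.
  - exists (geod z (lin (1 / k) N 0 N) (e / 2)). rewrite delta_geod0, V by (try apply T; lra). split; nra.
Qed.

Lemma cross_neg a b : a <> b -> bil (cross (emb a) (emb b)) (cross (emb a) (emb b)) < 0.
Proof.
  intros H. rewrite cross_sqr, !bil_emb_refl, <- cosh_delta. apply delta_gt0, sinh_gt0 in H.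
  pose proof (cosh_sqr (delta a b)). nra.
Qed.

(** Along a geodesic [f = bil N] is a combination of [cosh] and [sinh], so [f r * sinh (t - s) + f t
    * sinh (s - r) = f s * sinh (t - r)]. *)
Lemma geod_height_sign (N : vec) a u r s t : tangent a u -> r < s < t ->
  bil N (emb (geod a u s)) = 0 ->
  bil N (emb (geod a u r)) <> 0 ->
  bil N (emb (geod a u r)) * bil N (emb (geod a u t)) < 0.
Proof.
  intros T H H0 H1. rewrite !emb_geod, !bil_linr in * by auto.
  set (p := bil N (emb a)) in *. set (q := bil N u) in *.
  set (fr := cosh r * p + sinh r * q) in *. set (ft := cosh t * p + sinh t * q) in *.
  assert (K : fr * sinh (t - s) + ft * sinh (s - r) = 0).
  { transitivity ((cosh s * p + sinh s * q) * sinh (t - r)); [|rewrite H0; ring].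
    unfold fr, ft. rewrite !sinh_sub.
    pose proof (cosh_sqr s). pose proof (cosh_sqr r). pose proof (cosh_sqr t). ring_simplify. ring. }
  assert (0 < sinh (t - s)) by (apply sinh_gt0; lra). assert (0 < sinh (s - r)) by (apply sinh_gt0; lra).
  assert (fr * ft * sinh (s - r) = - (fr * fr) * sinh (t - s)) by nra.
  assert (0 < fr * fr) by nra. nra.
Qed.

(** * Crossing three consecutive sides *)

(* By hyperbolic trigonometry, the distance to a ray from the point at distance [t] from its
   origin on a ray making with it an angle of sine [sg] (or [sg = 1] if the angle is obtuse). *)
Definition ray_dist (sg t : R) : R := arcsinh (sg * sinh t).

Lemma ray_dist_1 t : ray_dist 1 t = t.
Proof. unfold ray_dist. rewrite Rmult_1_l. apply arcsinh_sinh. Qed.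

Lemma ray_dist_le sg sg' t t' : 0 <= sg <= sg' -> 0 <= t <= t' -> ray_dist sg t <= ray_dist sg' t'.
Proof.
  intros H H'. apply arcsinh_le. assert (0 <= sinh t) by (apply sinh_ge0; lra).
  assert (sinh t <= sinh t') by (apply sinh_le; lra). nra.
Qed.

Lemma ray_dist_ge0 sg t : 0 <= sg -> 0 <= t -> 0 <= ray_dist sg t.
Proof. intros. apply arcsinh_ge0. apply Rmult_le_pos; auto. now apply sinh_ge0. Qed.

(* After taking [cosh], this is the Cauchy-Schwarz inequality for the vectors
   [(sqrt (1 - sg^2), sg * cosh r)] and [(sqrt (1 - sg^2), sg * cosh t)]. *)
Lemma ray_dist_midpoint sg r t : 0 <= sg <= 1 -> 0 <= r -> 0 <= t ->
  2 * ray_dist sg ((r + t) / 2) <= ray_dist sg r + ray_dist sg t.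
Proof.
  intros Hsg Hr Ht.
  assert (G1 := ray_dist_ge0 sg r ltac:(lra) Hr). assert (G2 := ray_dist_ge0 sg t ltac:(lra) Ht).
  apply cosh_le_inv; [lra|]. rewrite cosh_double, cosh_add.
  assert (C1 := cosh_sqr (ray_dist sg r)). assert (C2 := cosh_sqr (ray_dist sg t)).
  assert (P1 := cosh_pos (ray_dist sg r)). assert (P2 := cosh_pos (ray_dist sg t)).
  assert (S : forall u, sinh (ray_dist sg u) = sg * sinh u) by (intros; apply sinh_arcsinh).
  rewrite !S in *.
  assert (D := cosh_double ((r + t) / 2)). replace (2 * ((r + t) / 2)) with (r + t) in D by field.
  rewrite cosh_add in D.
  assert (K1 := cosh_sqr r). assert (K2 := cosh_sqr t).
  assert (Q1 := cosh_ge1 r). assert (Q2 := cosh_ge1 t).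
  set (X := cosh (ray_dist sg r)) in *. set (Y := cosh (ray_dist sg t)) in *.
  set (a := sg * sg). assert (Ha : 0 <= a <= 1) by (unfold a; split; nra).
  assert (XY : 1 - a + a * (cosh r * cosh t) <= X * Y).
  { assert (Z1 : 0 <= a * (cosh r * cosh t)) by (apply Rmult_le_pos; nra).
    assert (Z2 : 0 <= 1 - a + a * (cosh r * cosh t)) by lra.
    assert (EX : X * X = 1 - a + a * (cosh r * cosh r)) by (rewrite K1, C1; unfold a; ring).
    assert (EY : Y * Y = 1 - a + a * (cosh t * cosh t)) by (rewrite K2, C2; unfold a; ring).
    assert (I : (1 - a + a * (cosh r * cosh t)) ^ 2 <= (X * Y) ^ 2).
    { replace ((X * Y) ^ 2) with ((X * X) * (Y * Y)) by ring. rewrite EX, EY.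
      assert (0 <= (1 - a) * a * (cosh r - cosh t) ^ 2).
      { apply Rmult_le_pos; [nra|apply pow2_ge_0]. }
      nra. }
    assert (0 < X * Y) by nra. nra. }
  replace (1 + 2 * (sg * sinh ((r + t) / 2) * (sg * sinh ((r + t) / 2))))
    with (1 + a * (2 * (sinh ((r + t) / 2) * sinh ((r + t) / 2)))) by (unfold a; ring).
  replace (2 * (sinh ((r + t) / 2) * sinh ((r + t) / 2))) with (cosh r * cosh t + sinh r * sinh t - 1) by lra.
  replace (sg * sinh r * (sg * sinh t)) with (a * (sinh r * sinh t)) by (unfold a; ring).
  nra.
Qed.

Lemma cosh_delta_geod p u w s t : tangent p u -> tangent p w ->
  cosh (delta (geod p u s) (geod p w t)) = cosh s * cosh t - (- bil u w) * (sinh s * sinh t).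
Proof.
  intros Hu Hw. rewrite cosh_delta, !emb_geod by auto.
  rewrite !bil_linl, !bil_linr, (bilC u (emb p)), bil_emb_refl, (proj1 Hu), (proj1 Hw). ring.
Qed.

Lemma tangent_bil_le1 p u w : tangent p u -> tangent p w -> - bil u w <= 1.
Proof.
  intros [H1 H2] [H3 H4]. pose proof (gram (emb p) u w) as K.
  rewrite bil_emb_refl, H1, H2, H3, H4 in K. nra.
Qed.

(** [sg] is the sine of the angle at [p], or 1 if that angle is not acute. The second clause bounds
    the distance to a side by that to its ray. In the third, [E] stands for any lower bound such as
    [epsilon_P]; both midpoints enter because the perpendicular from the midpoint of [p q] may miss
    the side [p a]. *)
Lemma corner_bound p q a : p <> q -> p <> a ->
  exists sg, 0 <= sg <= 1 /\
    (forall x c, segment p q c -> segment p a x -> ray_dist sg (delta p c) <= delta x c) /\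
    (forall E, (forall m f, midpoint p q m -> segment p a f -> E <= delta m f) ->
       (forall m f, midpoint p a m -> segment p q f -> E <= delta m f) ->
       E <= ray_dist sg (delta p q / 2)).
Proof.
  intros Hq Ha.
  set (u := dir p a). set (w := dir p q).
  assert (Tu : tangent p u) by now apply tangent_dir. assert (Tw : tangent p w) by now apply tangent_dir.
  assert (Lq := delta_gt0 _ _ Hq). assert (La := delta_gt0 _ _ Ha).
  assert (Sa : forall s, 0 <= s <= delta p a -> segment p a (geod p u s)).
  { intros s Hs. now apply segment_geod_dir_in. }
  assert (Sq : forall s, 0 <= s <= delta p q -> segment p q (geod p w s)).
  { intros s Hs. now apply segment_geod_dir_in. }
  assert (Ma : midpoint p a (geod p u (delta p a / 2))).
  { assert (K := Sa (delta p a / 2) ltac:(lra)). unfold segment in K.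
    rewrite delta_geod0 in K by (auto; lra). split; [rewrite delta_geod0; auto; lra|lra]. }
  assert (Mq : midpoint p q (geod p w (delta p q / 2))).
  { assert (K := Sq (delta p q / 2) ltac:(lra)). unfold segment in K.
    rewrite delta_geod0 in K by (auto; lra). split; [rewrite delta_geod0; auto; lra|lra]. }
  (* The cosine of the angle at [p]; the sign comes from the norm -1 of tangent vectors. *)
  set (k := - bil u w). assert (Hk : k <= 1) by now apply tangent_bil_le1 with p.
  destruct (Rle_or_lt k 0) as [Hk0|Hk0].
  - exists 1. split; [lra|]. split.
    + intros x c Hc Hx. rewrite ray_dist_1.
      rewrite (segment_geod_dir p q c), (segment_geod_dir p a x) by auto. fold u w.
      assert (0 <= delta p x) by apply delta_ge0. assert (Z := delta_ge0 p c).
      rewrite delta_geod0 by auto.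
      apply cosh_le_inv; [apply delta_ge0|]. rewrite cosh_delta_geod by auto. fold k.
      pose proof (sinh_ge0 _ H). pose proof (sinh_ge0 _ Z). pose proof (cosh_ge1 (delta p x)).
      pose proof (cosh_ge1 (delta p c)). assert (0 <= sinh (delta p x) * sinh (delta p c)) by nra. nra.
    + intros E H1 _. rewrite ray_dist_1. rewrite <- (proj1 Mq), (deltaC p). apply H1; auto. apply segment_left.
  - set (sg := sqrt (1 - k * k)).
    assert (Hsg : sg * sg = 1 - k * k) by (apply sqrt_sqrt; nra).
    assert (Hsg0 : 0 <= sg) by apply sqrt_pos. assert (Hsg1 : sg <= 1) by nra. clearbody sg.
    exists sg. split; [lra|].
    assert (LB : forall s t, 0 <= s -> 0 <= t -> ray_dist sg t <= delta (geod p u s) (geod p w t)).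
    { intros s t Hs Ht. apply sinh_le_inv. unfold ray_dist. rewrite sinh_arcsinh.
      set (d := delta (geod p u s) (geod p w t)).
      assert (Hd : 0 <= sinh d) by apply sinh_ge0, delta_ge0.
      assert (Cd : cosh d = cosh s * cosh t - k * (sinh s * sinh t)) by now apply cosh_delta_geod.
      assert (K := cosh_sqr d). rewrite Cd in K.
      assert (Ks := cosh_sqr s). assert (Kt := cosh_sqr t). assert (Z := sinh_ge0 _ Ht).
      assert (I : (sg * sinh t) ^ 2 <= sinh d * sinh d).
      { replace ((sg * sinh t) ^ 2) with ((sg * sg) * (sinh t * sinh t)) by ring. rewrite Hsg.
        assert (0 <= (sinh s * cosh t - k * (sinh t * cosh s)) ^ 2) by apply pow2_ge_0.
        replace (sinh d * sinh d) with
          ((sinh s * cosh t - k * (sinh t * cosh s)) ^ 2 + (1 - k * k) * (sinh t * sinh t)); [lra|].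
        transitivity ((cosh s * cosh t - k * (sinh s * sinh t)) * (cosh s * cosh t - k * (sinh s * sinh t)) - 1); [|lra].
        clear - Ks Kt. set (x := sinh s) in *. set (y := sinh t) in *. set (X := cosh s) in *. set (Y := cosh t) in *.
        transitivity (x * x * (Y * Y) - 2 * k * (x * Y * y * X) + k * k * (y * y) * (X * X) + (1 - k * k) * (y * y)); [ring|].
        transitivity ((X * X) * (Y * Y) - 2 * k * (x * Y * y * X) + k * k * (x * x) * (y * y) - 1); [|ring].
        rewrite Ks, Kt. ring. }
      assert (0 <= sg * sinh t) by nra. nra. }
    (* Foot of the perpendicular. In the right triangle [e] is [cosh] of the distance, so
       [cosh s = cosh t / e] and [sinh s = k * sinh t / e]. *)
    assert (FT : forall t, 0 <= t -> exists s, 0 <= s <= t /\ delta (geod p u s) (geod p w t) = ray_dist sg t).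
    { intros t Ht. set (e := sqrt (1 + sg * sg * (sinh t * sinh t))).
      assert (Z := sinh_ge0 _ Ht).
      assert (Ee : e * e = 1 + sg * sg * (sinh t * sinh t)) by (apply sqrt_sqrt; nra).
      assert (He : 1 <= e) by (assert (0 <= e) by apply sqrt_pos; nra). clearbody e.
      set (s := arcsinh (k * sinh t / e)).
      assert (S1 : sinh s = k * sinh t / e) by apply sinh_arcsinh.
      assert (Kt := cosh_sqr t). assert (Ks := cosh_sqr s). assert (Pt := cosh_pos t). assert (Ps := cosh_pos s).
      assert (Ee2 : e * e = cosh t * cosh t - k * k * (sinh t * sinh t)) by (rewrite Kt, Ee, Hsg; ring).
      assert (CE : (cosh s * e) * (cosh s * e) = cosh t * cosh t).
      { transitivity ((cosh s * cosh s) * (e * e)); [ring|]. rewrite Ks, S1.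
        transitivity (e * e + k * k * (sinh t * sinh t)); [field; lra|]. lra. }
      assert (C1 : cosh s = cosh t / e).
      { assert (0 < cosh s * e) by nra. assert (cosh s * e = cosh t) by nra. rewrite <- H0. field. lra. }
      exists s. split; [split|].
      - apply arcsinh_ge0, Rmult_le_pos; [nra|]. left; apply Rinv_0_lt_compat; lra.
      - apply sinh_le_inv. rewrite S1. apply Rle_div_l; nra.
      - apply cosh_inj; [apply delta_ge0|apply ray_dist_ge0; auto|].
        rewrite cosh_delta_geod by auto. fold k. rewrite C1, S1.
        assert (CR := cosh_sqr (ray_dist sg t)). assert (PR := cosh_pos (ray_dist sg t)).
        unfold ray_dist in CR at 3 4. rewrite sinh_arcsinh in CR.
        assert (CRe : cosh (ray_dist sg t) * cosh (ray_dist sg t) = e * e) by (rewrite CR, Ee; ring).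
        assert (cosh (ray_dist sg t) = e) by nra. rewrite H.
        transitivity ((cosh t * cosh t - k * k * (sinh t * sinh t)) / e); [field; lra|].
        rewrite <- Ee2. field. lra. }
    split.
    + intros x c Hc Hx.
      rewrite (segment_geod_dir p q c), (segment_geod_dir p a x) by auto. fold u w.
      rewrite delta_geod0 by (auto; apply delta_ge0). apply LB; apply delta_ge0.
    + intros E H1 H2.
      destruct (FT (delta p q / 2)) as (s0 & Hs0 & F0); [lra|].
      destruct (Rle_or_lt s0 (delta p a)) as [L|L].
      * rewrite <- F0, deltaC. apply H1; auto. apply Sa. lra.
      * (* The foot lies beyond [a], so [p a] is the shorter side: use its midpoint instead. *)
        apply Rle_trans with (ray_dist sg (delta p a / 2)); [|apply ray_dist_le; lra].
        assert (Sym : exists s, 0 <= s <= delta p a / 2 /\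
          delta (geod p u (delta p a / 2)) (geod p w s) = ray_dist sg (delta p a / 2)).
        { destruct (FT (delta p a / 2)) as (s & Hs & F); [lra|]. exists s. split; auto. rewrite <- F.
          apply cosh_inj; try apply delta_ge0. rewrite !cosh_delta_geod by auto. ring. }
        destruct Sym as (s & Hs & F). rewrite <- F. apply H2; auto. apply Sq. lra.
Qed.

Lemma midpointC a b m : midpoint a b m <-> midpoint b a m.
Proof. unfold midpoint. rewrite (deltaC a b), (deltaC a m), (deltaC m b). tauto. Qed.

(** The corners at [p] and [q] have different sines, whereas [ray_dist_midpoint] speaks of one.
    Putting the smaller sine at both ends only lowers the sum, and the corner it belongs to still
    provides [E] at the midpoint. *)
Lemma three_sides_bound p q a b x c y E : p <> q -> p <> a -> q <> b ->
  segment p q c -> segment p a x -> segment q b y ->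
  (forall m f, midpoint p q m -> segment p a f -> E <= delta m f) ->
  (forall m f, midpoint p a m -> segment p q f -> E <= delta m f) ->
  (forall m f, midpoint p q m -> segment q b f -> E <= delta m f) ->
  (forall m f, midpoint q b m -> segment p q f -> E <= delta m f) ->
  2 * E <= delta x c + delta c y.
Proof.
  intros Hpq Hpa Hqb Hc Hx Hy E1 E2 E3 E4.
  destruct (corner_bound p q a Hpq Hpa) as (s1 & B1 & L1 & M1).
  destruct (corner_bound q p b (not_eq_sym Hpq) Hqb) as (s2 & B2 & L2 & M2).
  specialize (L1 x c Hc Hx). specialize (M1 E E1 E2).
  specialize (L2 y c (proj1 (segmentC _ _ _) Hc) Hy). rewrite (deltaC y c), (deltaC q c) in L2.
  assert (F2 : E <= ray_dist s2 (delta p q / 2)).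
  { rewrite (deltaC p q). apply M2; intros m f Hm Hf.
    - apply E3; auto. now apply midpointC.
    - apply E4; auto. now apply segmentC. }
  clear M2. unfold segment in Hc. assert (P1 := delta_ge0 p c). assert (P2 := delta_ge0 c q).
  assert (K : forall s, 0 <= s <= 1 -> E <= ray_dist s (delta p q / 2) ->
    2 * E <= ray_dist s (delta p c) + ray_dist s (delta c q)).
  { intros s Hs HE. eapply Rle_trans; [|apply ray_dist_midpoint; auto].
    replace (delta p c + delta c q) with (delta p q). lra. }
  destruct (Rle_or_lt s1 s2) as [H|H].
  - specialize (K s1 B1 M1). assert (ray_dist s1 (delta c q) <= ray_dist s2 (delta c q)) by (apply ray_dist_le; lra). lra.
  - specialize (K s2 B2 F2). assert (ray_dist s2 (delta p c) <= ray_dist s1 (delta p c)) by (apply ray_dist_le; lra). lra.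
Qed.

(** * Convex polygons *)

(** For covers indexed by radii, a finite subcover yields one radius; non-positive entries are
    ignored. *)
Lemma list_pos_lower_bound (l : list R) :
  exists e, 0 < e /\ forall r, In r l -> 0 < r -> e <= r.
Proof.
  induction l as [|a l (e & He & H)].
  - exists 1. split; [lra|]. intros r [].
  - destruct (Rlt_or_le 0 a) as [Ha|Ha].
    + exists (Rmin a e). split; [now apply Rmin_pos|]. intros r [<-|Hr] Hr0; [apply Rmin_l|].
      eapply Rle_trans; [apply Rmin_r|auto].
    + exists e. split; auto. intros r [<-|Hr] Hr0; [lra|auto].
Qed.

Lemma list_upper_bound (l : list R) : exists M, forall r, In r l -> r <= M.
Proof.
  induction l as [|a l (M & H)].
  - exists 0. intros r [].
  - exists (Rmax a M). intros r [<-|Hr]; [apply Rmax_l|]. eapply Rle_trans; [|apply Rmax_r]. auto.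
Qed.

Lemma compact_closed K z : is_compact K ->
  (forall e, 0 < e -> exists w, delta z w < e /\ K w) -> K z.
Proof.
  intros HK H. apply NNPP. intros Hz.
  (* Cover by the complements of the closed balls of radius [r > 0] about [z]. *)
  destruct (HK R (fun r w => 0 < r /\ r < delta z w)) as (l & Hl).
  - intros r w [Hr Hw]. exists (delta z w - r). split; [lra|]. intros x Hx. split; auto.
    pose proof (delta_triangle z x w). rewrite (deltaC x w) in H0. lra.
  - intros w Hw. exists (delta z w / 2). assert (0 < delta z w) by (apply delta_gt0; congruence). lra.
  - destruct (list_pos_lower_bound l) as (e & He & Hel).
    destruct (H e He) as (w & Hw & Kw). destruct (Hl w Kw) as (r & Hr & Hr0 & Hrw).
    specialize (Hel r Hr Hr0). lra.
Qed.

Lemma compact_bounded K z : is_compact K -> exists M, forall w, K w -> delta z w < M.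
Proof.
  intros HK. destruct (HK R (fun r w => delta z w < r)) as (l & Hl).
  - intros r w Hw. exists (r - delta z w). split; [lra|]. intros x Hx. now apply ball_trans with w.
  - intros w _. exists (delta z w + 1). lra.
  - destruct (list_upper_bound l) as (M & HM). exists M. intros w Kw.
    destruct (Hl w Kw) as (r & Hr & Hrw). specialize (HM r Hr). lra.
Qed.

(** The last exit, not the first: never meeting the tile again is what makes runs terminate. *)
Lemma last_exit K a u r L : is_compact K -> tangent a u -> r <= L ->
  K (geod a u r) -> ~ K (geod a u L) ->
  exists s, r <= s < L /\ K (geod a u s) /\ forall t, s < t <= L -> ~ K (geod a u t).
Proof.
  intros HK T HrL Kr KL.
  destruct (completeness (fun t => r <= t <= L /\ K (geod a u t))) as (s & Hub & Hlub).
  - exists L. intros t [Ht _]. lra.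
  - exists r. split; auto; lra.
  - assert (Hrs : r <= s) by (apply Hub; split; auto; lra).
    assert (HsL : s <= L) by (apply Hlub; intros t [Ht _]; lra).
    assert (Ks : K (geod a u s)).
    { apply compact_closed; auto. intros e He. apply NNPP. intros N.
      assert (s <= s - e); [|lra]. apply Hlub. intros t [Ht Kt].
      destruct (Rle_or_lt t (s - e)) as [|h]; auto. exfalso. apply N.
      exists (geod a u t). split; auto. rewrite delta_geod by auto.
      assert (t <= s) by (apply Hub; split; auto). rewrite Rabs_right; lra. }
    assert (HsL' : s <> L) by (intros ->; auto).
    exists s. split; [lra|]. split; auto. intros t Ht Kt.
    assert (t <= s); [|lra]. apply Hub. split; auto; lra.
Qed.

Lemma exit_boundary K a u s L : is_compact K -> tangent a u -> s < L ->
  K (geod a u s) -> (forall t, s < t <= L -> ~ K (geod a u t)) -> boundary K (geod a u s).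
Proof.
  intros HK T HsL Ks H e He. split.
  - exists (geod a u s). now rewrite delta_refl.
  - set (t := Rmin L (s + e / 2)). assert (s < t) by (apply Rmin_glb_lt; lra).
    assert (t <= L) by apply Rmin_l. assert (t <= s + e / 2) by apply Rmin_r.
    exists (geod a u t). split; [|apply H; lra]. rewrite delta_geod by auto. rewrite Rabs_left; lra.
Qed.

Lemma interior_in A z : interior A z -> A z.
Proof. intros (e & He & H). apply H. now rewrite delta_refl. Qed.

Lemma interior_not_boundary A z : interior A z -> ~ boundary A z.
Proof. intros (e & He & H) B. destruct (B e He) as [_ (w & Hw & N)]. auto. Qed.

(** [cosh] of the distance to [y] is linear in [emb x], and norm 1 forces the coefficients to
    satisfy [s + t <= 1]. *)
Lemma segment_delta_max a b x y : segment a b x -> delta x y <= Rmax (delta a y) (delta b y).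
Proof.
  intros S. destruct (segment_lin _ _ _ S) as (s & t & Hs & Ht & E).
  assert (M1 := Rmax_l (delta a y) (delta b y)). assert (M2 := Rmax_r (delta a y) (delta b y)).
  set (M := Rmax (delta a y) (delta b y)) in *.
  assert (P1 := delta_ge0 a y). assert (P2 := delta_ge0 b y).
  apply cosh_le_inv; [lra|].
  rewrite cosh_delta, E, bil_linl, <- !cosh_delta.
  assert (cosh (delta a y) <= cosh M) by (apply cosh_le; lra).
  assert (cosh (delta b y) <= cosh M) by (apply cosh_le; lra).
  pose proof (bil_emb_refl x) as K. rewrite E, !bil_linl, !bil_linr, !bil_emb_refl, (bilC (emb b)), <- cosh_delta in K.
  pose proof (cosh_ge1 (delta a b)). pose proof (cosh_ge1 M).
  assert (0 <= s * t) by nra. assert (s * t <= s * t * cosh (delta a b)) by nra.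
  assert (s + t <= 1) by nra. nra.
Qed.

(** Either order of the end-points is allowed: two tiles may run through a common side in opposite
    directions, and a run names its common vertex first. *)
Definition is_edge (n : nat) (v : nat -> H2) (i : nat) (p q : H2) : Prop :=
  (p = v i /\ q = v (next n i)) \/ (p = v (next n i) /\ q = v i).

Lemma is_edge_sym n v i p q : is_edge n v i p q -> is_edge n v i q p.
Proof. unfold is_edge; tauto. Qed.

Lemma is_edge_side n v i p q z : is_edge n v i p q -> (side n v i z <-> segment p q z).
Proof. unfold side. intros [[-> ->]|[-> ->]]; [tauto|apply segmentC]. Qed.

Lemma is_edge_end n v i p q : is_edge n v i p q -> exists k, end_of_side n i k /\ p = v k.
Proof. unfold is_edge, end_of_side. intros [[-> _]|[-> _]]; eauto. Qed.

Lemma end_is_edge n v i k : end_of_side n i k -> exists q, is_edge n v i (v k) q.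
Proof. unfold is_edge, end_of_side. intros [-> | ->]; eauto. Qed.

Lemma is_edge_other n v i p q p' q' : is_edge n v i p q -> is_edge n v i p' q' ->
  (p = p' /\ q = q') \/ (p = q' /\ q = p').
Proof. unfold is_edge. intros [[-> ->]|[-> ->]] [[-> ->]|[-> ->]]; auto. Qed.

Lemma next_lt n i : (3 <= n)%nat -> (next n i < n)%nat.
Proof. intros H. unfold next. apply Nat.mod_upper_bound. lia. Qed.

Lemma next_neq n i : (3 <= n)%nat -> (i < n)%nat -> next n i <> i.
Proof.
  intros H Hi. unfold next. destruct (Nat.eq_dec (S i) n) as [E|E].
  - rewrite E, Nat.Div0.mod_same. lia.
  - rewrite Nat.mod_small; lia.
Qed.

Lemma end_of_side_lt n i k : (3 <= n)%nat -> (i < n)%nat -> end_of_side n i k -> (k < n)%nat.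
Proof. intros H Hi [-> | ->]; auto. now apply next_lt. Qed.

Lemma halfplane_open_sign (N : vec) (k : R) (c : H2) : 0 < k * bil N (emb c) ->
  exists e, 0 < e /\ forall w, delta c w < e -> 0 < k * bil N (emb w).
Proof.
  intros H. destruct (halfplane_open (lin k N 0 N) c) as (e & He & K).
  - rewrite bil_linl. lra.
  - exists e. split; auto. intros w Hw. specialize (K w Hw). rewrite bil_linl in K. lra.
Qed.

Lemma half_disk_interior (A : H2 -> Prop) a b x c s t : convex A -> A a -> A b -> A x ->
  0 < s -> 0 < t -> emb c = lin s (emb a) t (emb b) -> bil (cross (emb a) (emb b)) (emb x) <> 0 ->
  exists e, 0 < e /\ forall w, delta c w < e ->
    0 < bil (cross (emb a) (emb b)) (emb x) * bil (cross (emb a) (emb b)) (emb w) -> interior A w.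
Proof.
  intros HA Ha Hb Hx Hs Ht E HD.
  destruct (half_disk A a b x c s t) as (e & He & H); auto.
  exists e. split; auto. intros w Hw Hw0.
  destruct (halfplane_open_sign _ _ w Hw0) as (e' & He' & H').
  exists (Rmin e' (e - delta c w)). split; [apply Rmin_pos; lra|]. intros y Hy.
  assert (K1 := Rlt_le_trans _ _ _ Hy (Rmin_l _ _)). assert (K2 := Rlt_le_trans _ _ _ Hy (Rmin_r _ _)).
  apply H; [now apply ball_trans with w|]. apply Rlt_le, H'; auto.
Qed.

Lemma segment_lin_open p q c : segment p q c -> c <> p -> c <> q ->
  exists s t, 0 < s /\ 0 < t /\ emb c = lin s (emb p) t (emb q).
Proof.
  intros S Hp Hq. destruct (segment_lin _ _ _ S) as (s & t & Hs & Ht & E).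
  pose proof (bil_emb_refl c) as K. rewrite E, !bil_linl, !bil_linr, !bil_emb_refl in K.
  exists s, t. repeat split; auto.
  - destruct Hs as [|<-]; auto. exfalso. apply Hq, emb_inj. rewrite E. assert (t = 1) by nra. subst t. vec_ext; ring.
  - destruct Ht as [|<-]; auto. exfalso. apply Hp, emb_inj. rewrite E. assert (s = 1) by nra. subst s. vec_ext; ring.
Qed.

(* Each set contains a half-disk around [c]; these would overlap if the sets were on the same side
   of [p q], so the geodesic passes from one half-disk into the other. *)
Lemma cross_common_side (A A' : H2 -> Prop) p q c a u r s y : convex A -> convex A' ->
  A p -> A q -> A' p -> A' q -> p <> q -> segment p q c -> c <> p -> c <> q ->
  (forall z, interior A z -> bil (cross (emb p) (emb q)) (emb z) <> 0) ->
  (forall z, interior A' z -> bil (cross (emb p) (emb q)) (emb z) <> 0) ->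
  (forall z, interior A z -> interior A' z -> False) ->
  tangent a u -> r < s -> c = geod a u s -> interior A (geod a u r) -> interior A' y ->
  exists e, 0 < e /\ forall t, s < t < s + e -> interior A' (geod a u t).
Proof.
  intros CA CA' Ap Aq Ap' Aq' Hpq Sc Hcp Hcq NA NA' D T Hrs Ec Ir Iy.
  destruct (segment_lin_open _ _ _ Sc Hcp Hcq) as (s1 & t1 & Hs1 & Ht1 & E).
  set (N := cross (emb p) (emb q)) in *.
  assert (Hc : bil N (emb c) = 0) by (rewrite E, bil_linr; unfold N; rewrite bil_cross_l, bil_cross_r; ring).
  assert (Hx := NA _ Ir). assert (Hy := NA' _ Iy).
  destruct (half_disk_interior A p q (geod a u r) c s1 t1) as (e1 & He1 & H1); auto; [now apply interior_in|].
  destruct (half_disk_interior A' p q y c s1 t1) as (e2 & He2 & H2); auto; [now apply interior_in|].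
  fold N in H1, H2.
  assert (Opp : bil N (emb (geod a u r)) * bil N (emb y) < 0).
  { destruct (Rlt_or_le (bil N (emb (geod a u r)) * bil N (emb y)) 0) as [|h]; auto. exfalso.
    assert (h' : 0 < bil N (emb (geod a u r)) * bil N (emb y)).
    { destruct h as [|h]; auto. symmetry in h. apply Rmult_integral in h. tauto. }
    destruct (ball_off_line N c (Rmin e1 e2) Hc (cross_neg _ _ Hpq) (Rmin_pos _ _ He1 He2))
      as [(w1 & Hw1 & K1) (w2 & Hw2 & K2)].
    assert (Hw1a := Rlt_le_trans _ _ _ Hw1 (Rmin_l _ _)). assert (Hw1b := Rlt_le_trans _ _ _ Hw1 (Rmin_r _ _)).
    assert (Hw2a := Rlt_le_trans _ _ _ Hw2 (Rmin_l _ _)). assert (Hw2b := Rlt_le_trans _ _ _ Hw2 (Rmin_r _ _)).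
    destruct (Rlt_or_le 0 (bil N (emb y))) as [Z|Z].
    - assert (0 < bil N (emb (geod a u r))) by nra. apply (D w1); [apply H1|apply H2]; auto; nra.
    - assert (bil N (emb y) < 0) by lra. assert (bil N (emb (geod a u r)) < 0) by nra.
      apply (D w2); [apply H1|apply H2]; auto; nra. }
  exists e2. split; auto. intros t Ht. apply H2.
  - rewrite Ec, delta_geod, Rabs_left by (auto; lra). lra.
  - assert (K := geod_height_sign N a u r s t T ltac:(lra) ltac:(now rewrite <- Ec) Hx).
    set (X := bil N (emb (geod a u r))) in *. set (Y := bil N (emb y)) in *. set (Z := bil N (emb (geod a u t))) in *.
    assert (0 < (X * Y) * (X * Z)) by nra.
    assert (0 < X * X) by nra. replace ((X * Y) * (X * Z)) with ((X * X) * (Y * Z)) in H by ring. nra.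
Qed.

Section Polygon.
Variables (n : nat) (v : nat -> H2) (P : H2 -> Prop).
Hypothesis HP : convex_polygon n v P.

Lemma polygon_size : (3 <= n)%nat.
Proof. apply HP. Qed.

Lemma polygon_compact : is_compact P.
Proof. apply HP. Qed.

Lemma polygon_convex : convex P.
Proof. apply HP. Qed.

Lemma polygon_vertex_inj i j : (i < n)%nat -> (j < n)%nat -> v i = v j -> i = j.
Proof. apply HP. Qed.

Lemma polygon_boundary z : boundary P z <-> exists i, (i < n)%nat /\ side n v i z.
Proof. apply HP. Qed.

Lemma side_subset i z : (i < n)%nat -> side n v i z -> P z.
Proof.
  intros Hi Hz. apply compact_closed; [apply polygon_compact|]. intros e He.
  apply (proj2 (polygon_boundary z)); eauto.
Qed.

Lemma vertex_in i : (i < n)%nat -> P (v i).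
Proof. intros Hi. apply side_subset with i; auto. apply segment_left. Qed.

Lemma interior_not_side i z : (i < n)%nat -> interior P z -> ~ side n v i z.
Proof. intros Hi Hz Hs. apply (interior_not_boundary _ _ Hz), polygon_boundary. eauto. Qed.

Lemma is_edge_neq i p q : (i < n)%nat -> is_edge n v i p q -> p <> q.
Proof.
  intros Hi. pose proof (next_neq n i polygon_size Hi) as K. pose proof (next_lt n i polygon_size) as L.
  intros [[-> ->]|[-> ->]] E; apply polygon_vertex_inj in E; auto.
Qed.

Lemma is_edge_in i p q : (i < n)%nat -> is_edge n v i p q -> P p.
Proof.
  intros Hi E. destruct (is_edge_end _ _ _ _ _ E) as (k & Hk & ->). apply vertex_in.
  apply (end_of_side_lt n i); auto. apply polygon_size.
Qed.

Lemma adjacent_of_edges i j p q a : (i < n)%nat -> (j < n)%nat -> i <> j ->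
  is_edge n v i p q -> is_edge n v j p a -> adjacent n i j.
Proof.
  intros Hi Hj Hij E1 E2. split; auto.
  destruct (is_edge_end _ _ _ _ _ E1) as (k & Hk & ->). destruct (is_edge_end _ _ _ _ _ E2) as (l & Hl & E).
  assert (k = l) by (apply polygon_vertex_inj; eauto using end_of_side_lt, polygon_size). subst l.
  eauto.
Qed.

(** Otherwise a ball around [z] has points on both sides of the line. The half-disks they span with
    [p] and [q] fill a neighbourhood of the midpoint of the side, which is a boundary point. *)
Lemma interior_off_line i p q z : (i < n)%nat -> is_edge n v i p q -> interior P z ->
  bil (cross (emb p) (emb q)) (emb z) <> 0.
Proof.
  intros Hi E (e & He & Hz) H0.
  assert (Hpq := is_edge_neq _ _ _ Hi E).
  assert (Pp := is_edge_in _ _ _ Hi E). assert (Pq := is_edge_in _ _ _ Hi (is_edge_sym _ _ _ _ _ E)).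
  destruct (ball_off_line _ z e H0 (cross_neg _ _ Hpq) He) as [(w1 & Hw1 & K1) (w2 & Hw2 & K2)].
  set (d := delta p q). assert (Hd := delta_gt0 _ _ Hpq). fold d in Hd.
  set (c := geod p (dir p q) (d / 2)).
  assert (Sc : segment p q c) by (apply segment_geod_dir_in; auto; fold d; lra).
  assert (Dc : delta p c = d / 2) by (apply delta_geod0; [now apply tangent_dir|lra]).
  destruct (segment_lin_open p q c Sc) as (s & t & Hs & Ht & Ec).
  - intros X. rewrite X, delta_refl in Dc. lra.
  - intros X. rewrite X in Dc. fold d in Dc. lra.
  - destruct (half_disk P p q w1 c s t) as (e1 & He1 & H1); auto using polygon_convex; [lra|].
    destruct (half_disk P p q w2 c s t) as (e2 & He2 & H2); auto using polygon_convex; [lra|].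
    apply (interior_not_boundary P c).
    + exists (Rmin e1 e2). split; [now apply Rmin_pos|]. intros w Hw.
      destruct (Rle_or_lt 0 (bil (cross (emb p) (emb q)) (emb w))) as [Z|Z].
      * apply H1; [|nra]. eapply Rlt_le_trans; [exact Hw|apply Rmin_l].
      * apply H2; [|nra]. eapply Rlt_le_trans; [exact Hw|apply Rmin_r].
    + apply polygon_boundary. exists i. split; auto. now apply (is_edge_side _ _ _ _ _ _ E).
Qed.

(** Prolonging the geodesic from [v 0] through [z] to its last point in [P] puts [z] between a
    vertex and a point of a side, itself between two vertices; [segment_delta_max] applies twice. *)
Lemma delta_le_vertex z w : P z -> exists i, (i < n)%nat /\ delta z w <= delta (v i) w.
Proof.
  intros Hz. assert (N0 : (0 < n)%nat) by (pose proof polygon_size; lia).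
  destruct (classic (v 0%nat = z)) as [<-|Hne]; [exists 0%nat; split; auto; lra|].
  set (a := v 0%nat) in *. assert (T := tangent_dir a z Hne). set (u := dir a z) in *.
  destruct (compact_bounded P a polygon_compact) as (M & HM).
  assert (Hd := delta_gt0 _ _ Hne). assert (Ez : geod a u (delta a z) = z) by now apply geod_dir_end.
  assert (HMz := HM z Hz).
  destruct (last_exit P a u (delta a z) M) as (s & Hs & Ps & Hex); auto using polygon_compact.
  - lra.
  - now rewrite Ez.
  - intros PM. specialize (HM _ PM). rewrite delta_geod0 in HM by (auto; lra). lra.
  - assert (B := exit_boundary P a u s M polygon_compact T ltac:(lra) Ps Hex).
    apply polygon_boundary in B. destruct B as (i & Hi & Si).
    assert (S : segment a (geod a u s) z).
    { rewrite <- Ez at 1. rewrite <- (geod_0 a u) at 1. apply segment_of_geod; auto. lra. }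
    assert (K1 := segment_delta_max _ _ _ w S). assert (K2 := segment_delta_max _ _ _ w Si).
    unfold Rmax in *. repeat destruct Rle_dec in *.
    + exists (next n i). split; [apply next_lt, polygon_size|lra].
    + exists i. split; auto; lra.
    + exists 0%nat. split; auto.
    + exists 0%nat. split; auto.
Qed.

Lemma interior_dense z e : P z -> 0 < e -> exists w, delta z w < e /\ interior P w.
Proof.
  intros Hz He.
  destruct (proj1 (proj2 (proj2 (proj2 (proj2 (proj2 HP)))))) as (x & Hx).
  assert (Hn := polygon_size). assert (H0 : (0 < n)%nat) by lia.
  destruct (classic (interior P z)) as [I|I]; [exists z; now rewrite delta_refl|].
  assert (Hne : z <> x) by congruence.
  assert (T := tangent_dir z x Hne). set (u := dir z x) in *.
  assert (Hd := delta_gt0 _ _ Hne). assert (Ex : geod z u (delta z x) = x) by now apply geod_dir_end.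
  (* Half-disks on both sides of the geodesic [z x], spanned by points near [x] off that geodesic,
     make up a ball around a point of it close to [z]. *)
  set (s := Rmin (e / 2) (delta z x / 2)).
  assert (Hs : 0 < s) by (apply Rmin_pos; lra).
  assert (Hs1 : s <= e / 2) by apply Rmin_l. assert (Hs2 : s <= delta z x / 2) by apply Rmin_r.
  set (w := geod z u s).
  assert (Dw : delta z w = s) by (apply delta_geod0; auto; lra).
  assert (Sw : segment z x w) by (apply segment_geod_dir_in; auto; lra).
  destruct (segment_lin_open z x w Sw) as (p & q & Hp & Hq & E).
  { intros X. rewrite X, delta_refl in Dw. lra. }
  { intros X. rewrite X in Dw. lra. }
  exists w. split; [lra|].
  destruct Hx as (r & Hr & Hx).
  destruct (ball_off_line (cross (emb z) (emb x)) x r (bil_cross_r _ _) (cross_neg _ _ Hne) Hr)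
    as [(w1 & Hw1 & K1) (w2 & Hw2 & K2)].
  destruct (half_disk P z x w1 w p q) as (e1 & He1 & H1); auto using polygon_convex; [apply Hx; now rewrite delta_refl|lra|].
  destruct (half_disk P z x w2 w p q) as (e2 & He2 & H2); auto using polygon_convex; [apply Hx; now rewrite delta_refl|lra|].
  exists (Rmin e1 e2). split; [now apply Rmin_pos|]. intros y Hy.
  destruct (Rle_or_lt 0 (bil (cross (emb z) (emb x)) (emb y))) as [Z|Z].
  - apply H1; [|nra]. eapply Rlt_le_trans; [exact Hy|apply Rmin_l].
  - apply H2; [|nra]. eapply Rlt_le_trans; [exact Hy|apply Rmin_r].
Qed.

End Polygon.

(** * Tiles *)

Lemma interior_open A z : interior A z ->
  exists e, 0 < e /\ forall w, delta z w < e -> interior A w.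
Proof.
  intros (e & He & H). exists e. split; auto. intros w Hw. exists (e - delta z w). split; [lra|].
  intros x Hx. apply H. now apply ball_trans with w.
Qed.

(** Side pairings are given as equalities of sets; end-points are recovered as the only pair at
    maximal distance. *)
Lemma segment_endpoints a b a' b' : a <> b -> same_set (segment a b) (segment a' b') ->
  (a = a' /\ b = b') \/ (a = b' /\ b = a').
Proof.
  intros Hab H.
  assert (Sa := proj1 (H a) (segment_left a b)). assert (Sb := proj1 (H b) (segment_right a b)).
  assert (Sa' := proj2 (H a') (segment_left a' b')). assert (Sb' := proj2 (H b') (segment_right a' b')).
  destruct (classic (a' = b')) as [<-|Hab'].
  { apply segment_refl_eq in Sa. apply segment_refl_eq in Sb. congruence. }
  assert (L : forall x y x' y', x <> y -> segment x y x' -> segment x y y' -> delta x' y' <= delta x y).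
  { intros x y x' y' N Hx Hy. assert (Kx := Hx). assert (Ky := Hy). unfold segment in Kx, Ky.
    apply segment_geod_dir in Hx; auto. apply segment_geod_dir in Hy; auto.
    rewrite Hx, Hy. rewrite delta_geod by now apply tangent_dir.
    pose proof (delta_ge0 x x'). pose proof (delta_ge0 x y'). pose proof (delta_ge0 x' y). pose proof (delta_ge0 y' y).
    apply Rabs_le. lra. }
  assert (D : delta a b = delta a' b') by (apply Rle_antisym; auto).
  assert (Ga := segment_geod_dir _ _ _ Hab' Sa). assert (Gb := segment_geod_dir _ _ _ Hab' Sb).
  assert (Dab : delta a b = Rabs (delta a' a - delta a' b)).
  { rewrite Ga at 1. rewrite Gb at 1. apply delta_geod. now apply tangent_dir. }
  unfold segment in Sa, Sb.
  pose proof (delta_ge0 a' a). pose proof (delta_ge0 a' b). pose proof (delta_ge0 a b'). pose proof (delta_ge0 b b').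
  unfold Rabs in Dab. destruct Rcase_abs in Dab.
  - left. split; [symmetry|]; apply delta_eq0; lra.
  - right. split; [|symmetry]; apply delta_eq0; lra.
Qed.

(** * Transport along an isometry *)

Section Isometry.
Variables (g h : H2 -> H2).
Hypotheses (Hg : forall z w, delta (g z) (g w) = delta z w)
  (hg : forall z, h (g z) = z) (gh : forall z, g (h z) = z).

Lemma inverse_isometry z w : delta (h z) (h w) = delta z w.
Proof. rewrite <- Hg, !gh. reflexivity. Qed.

Lemma delta_inverse z w : delta (g z) w = delta z (h w).
Proof. rewrite <- inverse_isometry, hg. reflexivity. Qed.

Lemma image_iff A z : image g A z <-> A (h z).
Proof.
  split.
  - intros (w & Hw & ->). now rewrite hg.
  - intros H. exists (h z). now rewrite gh.
Qed.

Lemma segment_image a b z : segment (g a) (g b) z <-> segment a b (h z).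
Proof. unfold segment. rewrite Hg, delta_inverse, (deltaC z (g b)), delta_inverse, (deltaC b). tauto. Qed.

Lemma interior_image A z : interior (image g A) z <-> interior A (h z).
Proof.
  split; intros (e & He & H); exists e; split; auto; intros w Hw.
  - assert (K : image g A (g w)) by (apply H; rewrite deltaC, delta_inverse, deltaC; auto).
    apply image_iff in K. now rewrite hg in K.
  - apply image_iff, H. now rewrite inverse_isometry.
Qed.

Lemma boundary_image A z : boundary (image g A) z <-> boundary A (h z).
Proof.
  split; intros H e He; destruct (H e He) as [(w & Hw & Aw) (w' & Hw' & Aw')]; split.
  - exists (h w). rewrite inverse_isometry. split; auto. now apply image_iff.
  - exists (h w'). rewrite inverse_isometry. split; auto. intros K. now apply Aw', image_iff.
  - exists (g w). rewrite deltaC, delta_inverse, deltaC. split; auto. apply image_iff. now rewrite hg.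
  - exists (g w'). rewrite deltaC, delta_inverse, deltaC. split; auto. intros K. apply Aw'.
    apply image_iff in K. now rewrite hg in K.
Qed.

Lemma compact_image A : is_compact A -> is_compact (image g A).
Proof.
  intros HA I U HU Hc. destruct (HA I (fun i z => U i (g z))) as (l & Hl).
  - intros i z Hz. destruct (HU i (g z) Hz) as (e & He & K). exists e. split; auto.
    intros w Hw. apply K. now rewrite Hg.
  - intros z Hz. apply Hc. now exists z.
  - exists l. intros z (w & Hw & ->). now apply Hl.
Qed.

(** Lets every polygon lemma be applied to a tile, with sides numbered as in [P]. *)
Lemma polygon_image n v P : convex_polygon n v P ->
  convex_polygon n (fun i => g (v i)) (image g P).
Proof.
  intros (H1 & H2 & H3 & H4 & H5 & H6 & H7). split; [|split; [|split; [|split; [|split; [|split]]]]]; auto.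
  - intros i j Hi Hj E. apply H2; auto. rewrite <- (hg (v i)), E. apply hg.
  - intros i j z Hi Hj Hij Si Sj. apply segment_image in Si. apply segment_image in Sj.
    destruct (H3 i j (h z) Hi Hj Hij Si Sj) as (k & K1 & K2 & K3). exists k. split; auto. split; auto.
    now rewrite <- K3, gh.
  - now apply compact_image.
  - intros a b z Ha Hb Hz. apply image_iff in Ha. apply image_iff in Hb. apply image_iff.
    apply (H5 (h a) (h b)); auto. apply segment_image. now rewrite !gh.
  - destruct H6 as (z & Hz). exists (g z). apply interior_image. now rewrite hg.
  - intros z. rewrite boundary_image, H7. split; intros (i & Hi & S); exists i; split; auto.
    + now apply segment_image.
    + now apply segment_image in S.
Qed.

End Isometry.

(** * The tessellation *)

Section Tiling.
Variables (G : (H2 -> H2) -> Prop) (n : nat) (v : nat -> H2) (P : H2 -> Prop).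
Hypotheses (HG : subgroup G) (HP : fundamental_polygon G n v P).

Lemma G_isometry g z w : G g -> delta (g z) (g w) = delta z w.
Proof. intros H. apply delta_PSU11. now apply HG. Qed.

Lemma G_inverse g : G g -> exists h, G h /\ (forall z, h (g z) = z) /\ (forall z, g (h z) = z).
Proof. apply HG. Qed.

Lemma G_id : G (fun z => z).
Proof. apply HG. Qed.

Lemma G_comp g h : G g -> G h -> G (fun z => g (h z)).
Proof. apply HG. Qed.

Definition tile_vertex (h : H2 -> H2) (i : nat) : H2 := h (v i).

Lemma tile_polygon h : G h -> convex_polygon n (tile_vertex h) (image h P).
Proof.
  intros Gh. destruct (G_inverse h Gh) as (h' & _ & K1 & K2).
  apply (polygon_image h h'); auto. intros; now apply G_isometry. apply HP.
Qed.

Lemma common_interior_eq h1 h2 z : G h1 -> G h2 ->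
  interior (image h1 P) z -> interior (image h2 P) z -> forall w, h1 w = h2 w.
Proof.
  intros G1 G2 I1 I2.
  destruct (G_inverse h1 G1) as (k1 & Gk1 & K1 & K1'). destruct (G_inverse h2 G2) as (k2 & Gk2 & K2 & K2').
  apply (interior_image h1 k1) in I1; auto; [|intros; now apply G_isometry].
  apply (interior_image h2 k2) in I2; auto; [|intros; now apply G_isometry].
  intros w.
  assert (K : forall z, k1 (h2 z) = z).
  { apply (proj1 (proj2 (proj2 HP)) (fun z => k1 (h2 z))); [now apply G_comp|].
    exists (k2 z). split; auto. now rewrite K2'. }
  rewrite <- (K1' (h2 w)), K. reflexivity.
Qed.

(** The interior of a tile is dense in it, so the two tiles also share an interior point. *)
Lemma interior_tile_eq h1 h2 z : G h1 -> G h2 ->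
  interior (image h1 P) z -> image h2 P z -> forall w, h1 w = h2 w.
Proof.
  intros G1 G2 I1 I2. destruct (interior_open _ _ I1) as (e & He & H).
  destruct (interior_dense n (tile_vertex h2) (image h2 P) (tile_polygon h2 G2) z e I2 He) as (w & Hw & Iw).
  apply common_interior_eq with w; auto.
Qed.

(** The tile across side [i] of [h P] is [h g P], where [g] carries side [j] of [P] to side [i]. The
    interiors are disjoint because [g] is not the identity. *)
Lemma neighbor_tile h i : G h -> (i < n)%nat ->
  exists h' j, G h' /\ (j < n)%nat /\
    (forall p q, is_edge n (tile_vertex h) i p q -> is_edge n (tile_vertex h') j p q) /\
    (forall z, interior (image h P) z -> interior (image h' P) z -> False).
Proof.
  intros Gh Hi. destruct (proj2 (proj2 (proj2 HP)) i Hi) as (g & j & Gg & (z0 & Hz0) & Hj & S).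
  exists (fun z => h (g z)), j. split; [now apply G_comp|]. split; auto. split.
  - assert (Hij : (v i = g (v j) /\ v (next n i) = g (v (next n j))) \/
                  (v i = g (v (next n j)) /\ v (next n i) = g (v j))).
    { apply segment_endpoints.
      - intros E. assert (Z := proj1 HP). apply (polygon_vertex_inj n v P Z) in E; auto.
        + symmetry in E. revert E. apply next_neq; auto. apply (polygon_size n v P Z).
        + apply next_lt. apply (polygon_size n v P Z).
      - destruct (G_inverse g Gg) as (k & _ & K1 & K2). intros z. rewrite <- (S z).
        rewrite (image_iff g k) by auto. symmetry. apply (segment_image g k); auto.
        intros; now apply G_isometry. }
    unfold is_edge, tile_vertex. intros p q [[-> ->]|[-> ->]]; destruct Hij as [[-> ->]|[-> ->]]; auto.
  - intros z I1 I2. apply Hz0. destruct (G_inverse h Gh) as (k & _ & K1 & K2).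
    rewrite <- (K1 (g z0)). rewrite <- (common_interior_eq h (fun z => h (g z)) z); auto. now apply G_comp.
Qed.

(** * Tiles along a geodesic *)

Section Path.
Variables (a : H2) (u : vec) (L : R).
Hypothesis Hu : tangent a u.

Let X := geod a u.

Definition avoids_vertices (h : H2 -> H2) : Prop :=
  forall s k, 0 <= s <= L -> (k < n)%nat -> X s <> h (v k).

(** [s] is the last time in [h P]. As [X s] is not a vertex, the geodesic passes there into the
    interior of the tile across the side; [r'] is a time shortly after [s]. *)
Lemma next_tile h r : G h -> avoids_vertices h -> 0 <= r <= L -> interior (image h P) (X r) ->
  ~ image h P (X L) ->
  exists k s h' j r', r < s < r' /\ r' < L /\ (k < n)%nat /\ side n (tile_vertex h) k (X s) /\
    G h' /\ (j < n)%nat /\ interior (image h' P) (X r') /\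
    (forall p q, is_edge n (tile_vertex h) k p q -> is_edge n (tile_vertex h') j p q) /\
    (forall t, s < t <= L -> ~ image h P (X t)).
Proof.
  intros Gh Hav Hr Ir HL. assert (PT := tile_polygon h Gh).
  destruct (last_exit (image h P) a u r L) as (s & Hs & Ps & Hex); auto.
  { apply (polygon_compact _ _ _ PT). } { apply Hr. } { now apply interior_in. }
  assert (B := exit_boundary _ _ _ _ _ (polygon_compact _ _ _ PT) Hu (proj2 Hs) Ps Hex).
  assert (Hrs : r < s).
  { destruct (proj1 Hs) as [|<-]; auto. exfalso. now apply (interior_not_boundary _ _ Ir). }
  apply (polygon_boundary _ _ _ PT) in B. destruct B as (k & Hk & Sk).
  destruct (neighbor_tile h k Gh Hk) as (h' & j & Gh' & Hj & He & Hd).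
  assert (PT' := tile_polygon h' Gh').
  set (p := tile_vertex h k). set (q := tile_vertex h (next n k)).
  assert (E : is_edge n (tile_vertex h) k p q) by (left; auto).
  assert (E' := He _ _ E).
  destruct (proj1 (proj2 (proj2 (proj2 (proj2 (proj2 PT')))))) as (y & Iy).
  assert (Hn := polygon_size _ _ _ PT).
  destruct (cross_common_side (image h P) (image h' P) p q (X s) a u r s y) as (e & Hep & Hin); auto.
  - apply (polygon_convex _ _ _ PT).
  - apply (polygon_convex _ _ _ PT').
  - apply (is_edge_in _ _ _ PT k p q); auto.
  - apply (is_edge_in _ _ _ PT k q p); auto. now apply is_edge_sym.
  - apply (is_edge_in _ _ _ PT' j p q); auto.
  - apply (is_edge_in _ _ _ PT' j q p); auto. now apply is_edge_sym.
  - apply (is_edge_neq _ _ _ PT k p q); auto.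
  - apply Hav; auto. lra.
  - apply Hav; [lra|]. now apply next_lt.
  - intros z Iz. apply (interior_off_line _ _ _ PT k p q); auto.
  - intros z Iz. apply (interior_off_line _ _ _ PT' j p q); auto.
  - assert (0 < Rmin e (L - s)) by (apply Rmin_pos; lra).
    assert (Rmin e (L - s) <= e) by apply Rmin_l. assert (Rmin e (L - s) <= L - s) by apply Rmin_r.
    exists k, s, h', j, (s + Rmin e (L - s) / 2). repeat split; auto; try lra.
    apply Hin. lra.
Qed.

(** * Runs of sides with a common vertex *)

Variables (m : R) (K : nat) (lT : list (H2 -> H2)) (g : H2 -> H2).
Let T := Tset G n v P.
Hypotheses
  (Hm_far : forall i j x y, (i < n)%nat -> (j < n)%nat -> non_adjacent n i j ->
     side n v i x -> side n v j y -> m <= delta x y)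
  (Hm_mid : forall i j x y, (i < n)%nat -> (j < n)%nat -> adjacent n i j ->
     midpoint (v i) (v (next n i)) x -> side n v j y -> m <= 2 * delta x y)
  (HlT : forall t, T t -> In t lT)
  (Hav : forall h, set_pow T K h -> avoids_vertices h)
  (Gg : G g) (Hend : interior (image g P) (X L)).

Lemma T_id : T (fun z => z).
Proof.
  split; [apply G_id|]. left. intros z. split; [intros (w & Hw & ->); auto|]. intros Hz. now exists z.
Qed.

(** [set_pow] composes on the left, whereas a run leads from [h0 P] to [h0 t P]. *)
Lemma set_pow_snoc j h t : set_pow T j h -> T t -> set_pow T (S j) (fun z => h (t z)).
Proof.
  revert h. induction j as [|j IH]; intros h Hh Ht.
  - simpl in Hh. subst h. exists t, (fun z => z). split; [exact Ht|]. split; reflexivity.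
  - destruct Hh as (t1 & h1 & Ht1 & Hh1 & ->). exists t1, (fun z => h1 (t z)).
    split; [exact Ht1|]. split; auto.
Qed.

Lemma set_pow_le j k h : (j <= k)%nat -> set_pow T j h -> set_pow T k h.
Proof.
  induction 1 as [|k Hk IH]; auto. intros H. exists (fun z => z), h.
  split; [apply T_id|]. split; auto.
Qed.

Lemma set_pow_G j h : set_pow T j h -> G h.
Proof.
  revert h. induction j as [|j IH]; intros h Hh.
  - simpl in Hh. subst h. apply G_id.
  - destruct Hh as (t1 & h1 & Ht1 & Hh1 & ->). apply G_comp; auto. apply Ht1.
Qed.

(** The factor is [h0^-1 h], which sends [v k'] to [v k]. Extensionality enters because [set_pow]
    compares maps by equality. *)
Lemma shared_vertex_T h0 h k k' : G h0 -> G h -> (k < n)%nat -> (k' < n)%nat ->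
  h0 (v k) = h (v k') -> exists t, T t /\ h = (fun z => h0 (t z)).
Proof.
  intros G0 Gh Hk Hk' E. destruct (G_inverse h0 G0) as (h0' & G0' & K1 & K2).
  exists (fun z => h0' (h z)). split.
  - split; [now apply G_comp|]. destruct (classic (same_set (image (fun z => h0' (h z)) P) P)) as [|N]; auto.
    right. split; auto. right. exists k, k'. repeat split; auto. now rewrite <- E, K1.
  - apply functional_extensionality. intros z. now rewrite K2.
Qed.

Lemma far_sides h i j x y : G h -> (i < n)%nat -> (j < n)%nat -> non_adjacent n i j ->
  side n (tile_vertex h) i x -> side n (tile_vertex h) j y -> m <= delta x y.
Proof.
  intros Gh Hi Hj Hij Sx Sy. destruct (G_inverse h Gh) as (h' & _ & K1 & K2).
  assert (Iso : forall z w, delta (h z) (h w) = delta z w) by (intros; now apply G_isometry).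
  rewrite <- (inverse_isometry h h') by auto. apply (Hm_far i j); auto.
  - now apply (segment_image h h').
  - now apply (segment_image h h').
Qed.

Lemma mid_side h i j p q x y : G h -> (i < n)%nat -> (j < n)%nat -> adjacent n i j ->
  is_edge n (tile_vertex h) i p q -> midpoint p q x ->
  side n (tile_vertex h) j y -> m / 2 <= delta x y.
Proof.
  intros Gh Hi Hj Hij Ei Mx Sy. destruct (G_inverse h Gh) as (h' & _ & K1 & K2).
  assert (Iso : forall z w, delta (h z) (h w) = delta z w) by (intros; now apply G_isometry).
  rewrite <- (inverse_isometry h h') by auto.
  assert (m <= 2 * delta (h' x) (h' y)); [|lra].
  apply (Hm_mid i j); auto.
  - unfold midpoint. rewrite <- (Iso (v i)), <- (Iso (h' x)), <- (Iso (v i)), K2.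
    destruct Ei as [[-> ->]|[-> ->]]; auto. now apply midpointC.
  - now apply (segment_image h h').
Qed.

Definition reached : Prop := exists h, set_pow T K h /\ forall z, g z = h z.

Lemma reached_here j h : set_pow T j h -> (j <= K)%nat -> image h P (X L) -> reached.
Proof.
  intros Hh Hj HL. exists h. split; [now apply set_pow_le with j|].
  apply interior_tile_eq with (X L); auto. now apply set_pow_G with j.
Qed.

(** Sides are convex: entering and leaving through the same side would keep the geodesic in that
    side, away from the interior. *)
Lemma entered_side_neq h j k s r s' : G h -> (j < n)%nat ->
  s <= r <= s' -> interior (image h P) (X r) ->
  side n (tile_vertex h) j (X s) -> side n (tile_vertex h) k (X s') -> j <> k.
Proof.
  intros Gh Hj Hs Ir S S' <-.
  apply (interior_not_side _ _ _ (tile_polygon h Gh) j _ Hj Ir).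
  apply (convex_segment _ _ (X s) (X s')); auto. now apply segment_of_geod.
Qed.

Lemma adjacent_edges h i j : adjacent n i j ->
  exists p q b, is_edge n (tile_vertex h) i p q /\ is_edge n (tile_vertex h) j p b.
Proof.
  intros (_ & k & Hi & Hj). destruct (end_is_edge n (tile_vertex h) i k Hi) as (q & Eq).
  destruct (end_is_edge n (tile_vertex h) j k Hj) as (b & Eb). eauto.
Qed.

Lemma adjacent_sym i j : adjacent n i j -> adjacent n j i.
Proof. intros (N & k & Hi & Hj). split; auto. eauto. Qed.

(** State at the start of a run, with [N] runs still allowed and [j] factors used: at time [s] the
    geodesic leaves [h0 P] through side [i], which is side [i'] of the next tile [h P], and a length
    below [N * m] remains. *)
Definition follows (N : nat) : Prop :=
  forall j h0 i h i' s r, (j + N = K)%nat -> set_pow T j h0 -> (i < n)%nat ->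
    (i' < n)%nat -> G h ->
    (forall p q, is_edge n (tile_vertex h0) i p q -> is_edge n (tile_vertex h) i' p q) ->
    side n (tile_vertex h0) i (X s) ->
    0 <= s < r -> r < L -> interior (image h P) (X r) -> L - s < INR N * m -> reached.

Lemma advance N s s' : L - s < INR (S N) * m -> m <= s' - s -> L - s' < INR N * m.
Proof. rewrite S_INR. lra. Qed.

(* Invariant of a run: all sides crossed since time [s0] contain [p]; the last two are [p b] and [p q],
   at times [s1] and [s2]. The run ends because no tile is met again once left, so [l] shrinks. *)
Lemma follow_around_vertex N j h0 p s0 k0 : follows N -> (j + S N = K)%nat -> set_pow T j h0 ->
  (k0 < n)%nat -> p = h0 (v k0) -> 0 <= s0 -> L - s0 < INR (S N) * m ->
  forall l h1 i1 i2 b h2 j2 q s1 s2 r,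
    (forall t, T t -> (exists s, s2 < s <= L /\ image (fun z => h0 (t z)) P (X s)) -> In t l) ->
    G h1 -> (i1 < n)%nat -> (i2 < n)%nat -> i1 <> i2 ->
    is_edge n (tile_vertex h1) i1 p b -> is_edge n (tile_vertex h1) i2 p q ->
    G h2 -> (j2 < n)%nat -> is_edge n (tile_vertex h2) j2 p q ->
    segment p b (X s1) -> segment p q (X s2) ->
    s0 <= s1 <= s2 -> s2 < r < L -> interior (image h2 P) (X r) -> reached.
Proof.
  intros HN Hj Hh0 Hk0 Ep Hs0 HL l.
  remember (length l) as len eqn:Elen. revert l Elen.
  induction len as [len IH] using lt_wf_ind.
  intros l Elen h1 i1 i2 b h2 j2 q s1 s2 r Hl Gh1 Hi1 Hi2 Hi12 E1 E2 Gh2 Hj2 E2' S1 S2 Hs Hr Ir.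
  assert (G0 := set_pow_G _ _ Hh0).
  assert (PT2 := tile_polygon h2 Gh2). assert (PT1 := tile_polygon h1 Gh1).
  assert (Hn := polygon_size _ _ _ PT2).
  destruct (is_edge_end _ _ _ _ _ E2') as (k2 & Hk2 & Ep2).
  assert (Hk2n := end_of_side_lt _ _ _ Hn Hj2 Hk2).
  destruct (shared_vertex_T h0 h2 k0 k2 G0 Gh2 Hk0 Hk2n) as (t & Tt & Et).
  { rewrite <- Ep. exact Ep2. }
  assert (Hh2 : set_pow T (S j) h2) by (rewrite Et; now apply set_pow_snoc).
  destruct (classic (image h2 P (X L))) as [He|He].
  { apply reached_here with (S j) h2; auto. lia. }
  destruct (next_tile h2 r) as (k & s & h3 & j3 & r' & Hrs & Hr'L & Hk & Sk & Gh3 & Hj3 & Ir' & He3 & Hout); auto.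
  { apply Hav. apply set_pow_le with (S j); auto. lia. } { lra. }
  assert (Sj2 : side n (tile_vertex h2) j2 (X s2)) by now apply (is_edge_side _ _ _ _ _ _ E2').
  assert (Hjk : j2 <> k) by (apply (entered_side_neq h2 j2 k s2 r s); auto; lra).
  (* Once the run has cost [m], a new one starts with the side just crossed, from the tile [h2 P]
     with [h2] in [T^(j+1)]. *)
  assert (Next : m <= s - s0 -> reached).
  { intros Hms. apply (HN (S j) h2 k h3 j3 s r'); auto; try lia; try lra. now apply advance with s0. }
  destruct (classic (adjacent n j2 k)) as [Adj|NAdj].
  2:{ apply Next. assert (Z := far_sides h2 j2 k _ _ Gh2 Hj2 Hk (conj Hjk NAdj) Sj2 Sk).
      unfold X in Z. rewrite delta_geod, Rabs_left in Z by (auto; lra). lra. }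
  destruct (adjacent_edges h2 _ _ Adj) as (p' & q' & c & F1 & F2).
  destruct (is_edge_other _ _ _ _ _ _ _ E2' F1) as [[<- <-]|[<- <-]].
  (* The two sides meet at [p]: the run continues, and [t] is struck off the list since [h0 t P] is
     not met after time [s]. *)
  - destruct (in_split t l) as (l1 & l2 & El).
    { apply Hl; auto. exists r. split; [lra|]. rewrite <- Et. now apply interior_in. }
    apply (IH (length (l1 ++ l2))) with (l := l1 ++ l2) (h1 := h2) (i1 := j2) (i2 := k) (b := q)
      (h2 := h3) (j2 := j3) (q := c) (s1 := s2) (s2 := s) (r := r'); auto; try lra.
    + rewrite Elen, El, !length_app. simpl. lia.
    + intros t' Tt' (s' & Hs' & Is'). assert (Z : In t' l).
      { apply Hl; auto. exists s'. split; auto. lra. }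
      rewrite El in Z. apply in_app_or in Z. apply in_or_app. destruct Z as [Z|[Z|Z]]; auto.
      exfalso. subst t'. rewrite <- Et in Is'. now apply (Hout s').
    + now apply (is_edge_side _ _ _ _ _ _ F2).
  - apply Next.
    assert (A12 : adjacent n i1 i2) by (apply (adjacent_of_edges _ _ _ PT1 i1 i2 p b q); auto).
    assert (Sc : segment q c (X s)) by now apply (is_edge_side _ _ _ _ _ _ F2).
    (* The sides meet at [q], so [p b], [p q], [q c] are crossed in turn. Here [E = m / 2], and the
       two distances add up to [s - s1 <= s - s0]. *)
    assert (Z : 2 * (m / 2) <= delta (X s1) (X s2) + delta (X s2) (X s)).
    { apply (three_sides_bound p q b c); auto.
      - apply (is_edge_neq _ _ _ PT2 j2 p q); auto.
      - apply (is_edge_neq _ _ _ PT1 i1 p b); auto.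
      - apply (is_edge_neq _ _ _ PT2 k q c); auto.
      - intros x y Mx Sy. apply (mid_side h1 i2 i1 p q x y); auto using adjacent_sym.
        now apply (is_edge_side _ _ _ _ _ _ E1).
      - intros x y Mx Sy. apply (mid_side h1 i1 i2 p b x y); auto.
        now apply (is_edge_side _ _ _ _ _ _ E2).
      - intros x y Mx Sy. apply (mid_side h2 j2 k p q x y); auto.
        now apply (is_edge_side _ _ _ _ _ _ F2).
      - intros x y Mx Sy. apply (mid_side h2 k j2 q c x y); auto using adjacent_sym.
        now apply (is_edge_side _ _ _ _ _ _ E2'). }
    unfold X in Z. rewrite !delta_geod in Z by auto.
    rewrite (Rabs_left1 (s1 - s2)), (Rabs_left (s2 - s)) in Z by lra. lra.
Qed.

Lemma follow N : follows N.
Proof.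
  induction N as [|N IH]; intros j h0 i h i' s r Hj Hh0 Hi Hi' Gh He Ss Hs HrL Ir HL.
  { simpl in HL. lra. }
  assert (G0 := set_pow_G _ _ Hh0).
  assert (PT := tile_polygon h Gh). assert (Hn := polygon_size _ _ _ PT).
  assert (E0 : is_edge n (tile_vertex h0) i (tile_vertex h0 i) (tile_vertex h0 (next n i))) by (left; auto).
  assert (E := He _ _ E0).
  assert (Si' : side n (tile_vertex h) i' (X s)) by (apply (is_edge_side _ _ _ _ _ _ E); exact Ss).
  destruct (is_edge_end _ _ _ _ _ E) as (k2 & Hk2 & Ep2).
  assert (Hk2n := end_of_side_lt _ _ _ Hn Hi' Hk2).
  destruct (shared_vertex_T h0 h i k2 G0 Gh Hi Hk2n Ep2) as (t & Tt & Et).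
  assert (Hh : set_pow T (S j) h) by (rewrite Et; now apply set_pow_snoc).
  destruct (classic (image h P (X L))) as [HE|HE].
  { apply reached_here with (S j) h; auto. lia. }
  destruct (next_tile h r) as (k & s' & h3 & j3 & r' & Hrs & Hr'L & Hk & Sk & Gh3 & Hj3 & Ir' & He3 & Hout); auto.
  { apply Hav. apply set_pow_le with (S j); auto. lia. } { lra. }
  assert (Hjk : i' <> k) by (apply (entered_side_neq h i' k s r s'); auto; lra).
  destruct (classic (adjacent n i' k)) as [Adj|NAdj].
  (* Here the run consists of the single side crossed at [s], and the next one starts at [s'] from
     [h P]. *)
  2:{ apply (IH (S j) h k h3 j3 s' r'); auto; try lia; try lra. apply advance with s; auto.
      assert (Z := far_sides h i' k _ _ Gh Hi' Hk (conj Hjk NAdj) Si' Sk).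
      unfold X in Z. rewrite delta_geod, Rabs_left in Z by (auto; lra). lra. }
  destruct (adjacent_edges h _ _ Adj) as (p & q & c & F1 & F2).
  (* The pivot [p] is an end of the side shared with [h0 P], so it is also a vertex of that tile. *)
  assert (Hp : exists k0, (k0 < n)%nat /\ p = h0 (v k0)).
  { destruct (is_edge_other _ _ _ _ _ _ _ F1 E) as [[-> _]|[-> _]]; [exists i|exists (next n i)];
      split; auto. now apply next_lt. }
  destruct Hp as (k0 & Hk0 & Ep).
  apply (follow_around_vertex N j h0 p s k0 IH Hj Hh0 Hk0 Ep ltac:(lra) HL lT h i' k q h3 j3 c s s' r'); auto; try lra.
  - now apply (is_edge_side _ _ _ _ _ _ F1).
  - now apply (is_edge_side _ _ _ _ _ _ F2).
Qed.

Lemma path_reached : 0 <= L -> L < INR K * m -> interior P a -> reached.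
Proof.
  intros HL0 HL Ia. assert (H0 : set_pow T 0 (fun z => z)) by reflexivity.
  assert (EI : forall z, image (fun z => z) P z <-> P z).
  { intros z. split; [intros (w & Hw & ->); auto|intros Hz; now exists z]. }
  destruct (classic (image (fun z => z) P (X L))) as [HE|HE].
  { apply reached_here with 0%nat (fun z => z); auto. lia. }
  destruct (next_tile (fun z => z) 0) as (k & s' & h3 & j3 & r' & Hrs & Hr'L & Hk & Sk & Gh3 & Hj3 & Ir' & He3 & Hout); auto.
  { apply G_id. } { apply Hav. apply set_pow_le with 0%nat; auto. lia. } { lra. }
  { unfold X. rewrite geod_0. destruct Ia as (e & He & H). exists e. split; auto. intros w Hw. apply EI; auto. }
  apply (follow K 0%nat (fun z => z) k h3 j3 s' r'); auto; try lra.
Qed.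

End Path.
End Tiling.

(** * The constants of a polygon *)

Definition is_closed (C : H2 -> Prop) : Prop :=
  forall z, (forall e, 0 < e -> exists w, delta z w < e /\ C w) -> C z.

Lemma not_closed_point C z : is_closed C -> ~ C z ->
  exists e, 0 < e /\ forall w, delta z w < e -> ~ C w.
Proof.
  intros HC Hz. apply NNPP. intros N. apply Hz, HC. intros e He. apply NNPP. intros N'.
  apply N. exists e. split; auto. intros w Hw Cw. apply N'. eauto.
Qed.

Lemma segment_closed a b : is_closed (segment a b).
Proof.
  intros z H. apply Rle_antisym; [|apply delta_triangle].
  apply Rnot_lt_le. intros K.
  destruct (H ((delta a z + delta z b - delta a b) / 2)) as (w & Hw & S); [lra|].
  unfold segment in S. pose proof (delta_triangle a w z). pose proof (delta_triangle z w b).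
  rewrite (deltaC w z) in *. lra.
Qed.

Lemma compact_closed_subset K C : is_compact K -> is_closed C -> (forall z, C z -> K z) -> is_compact C.
Proof.
  intros HK HC CK I U HU Hcov.
  destruct (HK (option I) (fun o z => match o with Some i => U i z | None => ~ C z end)) as (l & Hl).
  - intros [i|] z Hz; [now apply HU|]. now apply not_closed_point.
  - intros z _. destruct (classic (C z)) as [Cz|Cz]; [|now exists None].
    destruct (Hcov z Cz) as (i & Hi). now exists (Some i).
  - exists (flat_map (fun o => match o with Some i => i :: nil | None => nil end) l).
    intros z Cz. destruct (Hl z (CK z Cz)) as ([i|] & Hi & Hz); [|contradiction].
    exists i. split; auto. apply in_flat_map. exists (Some i). split; auto. now left.
Qed.

Lemma compact_closed_apart K C : is_compact K -> is_closed C -> (forall z, K z -> C z -> False) ->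
  exists e, 0 < e /\ forall x y, K x -> C y -> e <= delta x y.
Proof.
  intros HK HC D.
  (* The margin between [r] and [r'] makes the condition open in [z]. *)
  destruct (HK R (fun r z => 0 < r /\ exists r', r < r' /\ forall w, delta z w < r' -> ~ C w)) as (l & Hl).
  - intros r z (Hr & r' & Hr' & H). exists ((r' - r) / 2). split; [lra|]. intros x Hx. split; auto.
    exists ((r' + r) / 2). split; [lra|]. intros w Hw. apply H.
    pose proof (delta_triangle z x w). lra.
  - intros z Kz. destruct (not_closed_point C z HC (D z Kz)) as (e & He & H).
    exists (e / 2). split; [lra|]. exists e. split; auto. lra.
  - destruct (list_pos_lower_bound l) as (e & He & Hel). exists e. split; auto. intros x y Kx Cy.
    destruct (Hl x Kx) as (r & Hr & Hr0 & r' & Hr' & H). specialize (Hel r Hr Hr0).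
    destruct (Rle_or_lt r' (delta x y)) as [|h]; [lra|]. now apply H in h.
Qed.

Lemma segments_apart K a b c d : is_compact K -> (forall z, segment a b z -> K z) ->
  (forall z, segment a b z -> segment c d z -> False) ->
  exists e, 0 < e /\ forall x y, segment a b x -> segment c d y -> e <= delta x y.
Proof.
  intros HK Hab D. apply compact_closed_apart; auto using segment_closed.
  apply compact_closed_subset with K; auto using segment_closed.
Qed.

Lemma uniform_positive n (Q : nat -> R -> Prop) :
  (forall i e e', e' <= e -> Q i e -> Q i e') ->
  (forall i, (i < n)%nat -> exists e, 0 < e /\ Q i e) ->
  exists e, 0 < e /\ forall i, (i < n)%nat -> Q i e.
Proof.
  intros HQ. induction n as [|n IH]; intros H.
  - exists 1. split; [lra|]. intros i Hi. lia.
  - destruct IH as (e & He & K); [intros i Hi; apply H; lia|]. destruct (H n) as (e' & He' & K'); [lia|].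
    exists (Rmin e e'). split; [now apply Rmin_pos|]. intros i Hi.
    destruct (Nat.eq_dec i n) as [->|]; [apply HQ with e'; auto using Rmin_r|].
    apply HQ with e; [apply Rmin_l|]. apply K. lia.
Qed.

Lemma uniform_positive2 n (Q : nat -> nat -> R -> Prop) :
  (forall i j e e', e' <= e -> Q i j e -> Q i j e') ->
  (forall i j, (i < n)%nat -> (j < n)%nat -> exists e, 0 < e /\ Q i j e) ->
  exists e, 0 < e /\ forall i j, (i < n)%nat -> (j < n)%nat -> Q i j e.
Proof.
  intros HQ H.
  destruct (uniform_positive n (fun i e => forall j, (j < n)%nat -> Q i j e)) as (e & He & K).
  - intros i e e' He K j Hj. apply HQ with e; auto.
  - intros i Hi. apply uniform_positive; eauto.
  - exists e. split; auto.
Qed.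

(** The lower bound rules out [m_infty]; the empty case is kept because [delta_P] of a triangle is
    [p_infty]. *)
Lemma Glb_ge (E : R -> Prop) e : (forall x, E x -> e <= x) ->
  (Glb_Rbar E = p_infty /\ forall x, ~ E x) \/
  (exists r, Glb_Rbar E = Finite r /\ e <= r /\ forall x, E x -> r <= x).
Proof.
  intros H. destruct (Glb_Rbar_correct E) as [L G].
  assert (Ge : Rbar_le e (Glb_Rbar E)) by (apply G; intros x Hx; now apply H).
  destruct (Glb_Rbar E) as [r| |]; [right|left|contradiction].
  - exists r. split; auto.
  - split; [reflexivity|]. intros x Hx. now apply (L x Hx).
Qed.

Section Constants.
Variables (n : nat) (v : nat -> H2) (P : H2 -> Prop).
Hypothesis HP : convex_polygon n v P.

Lemma midpoint_segment a b m : midpoint a b m -> segment a b m.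
Proof. unfold midpoint, segment. lra. Qed.

Lemma midpoint_unique a b m m' : a <> b -> midpoint a b m -> midpoint a b m' -> m = m'.
Proof.
  intros Hab M M'. rewrite (segment_geod_dir a b m), (segment_geod_dir a b m') by auto using midpoint_segment.
  now rewrite (proj1 M), (proj1 M').
Qed.

Lemma side_ends_neq i : (i < n)%nat -> v i <> v (next n i).
Proof. intros Hi. apply (is_edge_neq _ _ _ HP i); auto. now left. Qed.

Lemma midpoint_exists a b : a <> b -> exists m, midpoint a b m.
Proof.
  intros H. exists (geod a (dir a b) (delta a b / 2)). assert (K := delta_gt0 _ _ H).
  assert (S := segment_geod_dir_in a b (delta a b / 2) H ltac:(lra)). unfold segment in S.
  rewrite delta_geod0 in S by (try apply tangent_dir; auto; lra).
  split; [|lra]. rewrite delta_geod0; auto using tangent_dir; lra.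
Qed.

Lemma sides_far : exists e, 0 < e /\ forall i j, (i < n)%nat -> (j < n)%nat -> non_adjacent n i j ->
  forall x y, side n v i x -> side n v j y -> e <= delta x y.
Proof.
  apply (uniform_positive2 n (fun i j e => non_adjacent n i j ->
    forall x y, side n v i x -> side n v j y -> e <= delta x y)).
  - intros i j e e' He H N x y Sx Sy. specialize (H N x y Sx Sy). lra.
  - intros i j Hi Hj. destruct (classic (non_adjacent n i j)) as [[N A]|N].
    + destruct (segments_apart P (v i) (v (next n i)) (v j) (v (next n j))) as (e & He & H).
      * apply (polygon_compact _ _ _ HP).
      * intros z Sz. now apply (side_subset _ _ _ HP i).
      * intros z Si Sj. apply A. split; auto.
        destruct (proj1 (proj2 (proj2 HP)) i j z Hi Hj N Si Sj) as (k & K1 & K2 & _). eauto.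
      * exists e. split; auto.
    + exists 1. split; [lra|]. intros. contradiction.
Qed.

Lemma midpoints_far : exists e, 0 < e /\ forall i j, (i < n)%nat -> (j < n)%nat -> adjacent n i j ->
  forall x y, midpoint (v i) (v (next n i)) x -> side n v j y -> e <= delta x y.
Proof.
  apply (uniform_positive2 n (fun i j e => adjacent n i j ->
    forall x y, midpoint (v i) (v (next n i)) x -> side n v j y -> e <= delta x y)).
  - intros i j e e' He H N x y Sx Sy. specialize (H N x y Sx Sy). lra.
  - intros i j Hi Hj. destruct (classic (adjacent n i j)) as [A|N].
    + assert (Hne := side_ends_neq i Hi). assert (Hd := delta_gt0 _ _ Hne).
      destruct (midpoint_exists _ _ Hne) as (m & Hm).
      assert (Sm : side n v i m) by now apply midpoint_segment.
      destruct (segments_apart P m m (v j) (v (next n j))) as (e & He & H).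
      * apply (polygon_compact _ _ _ HP).
      * intros z Sz. apply segment_refl_eq in Sz. subst z. now apply (side_subset _ _ _ HP i).
      * intros z Sz Sj. apply segment_refl_eq in Sz. subst z.
        destruct (proj1 (proj2 (proj2 HP)) i j m Hi Hj (proj1 A) Sm Sj) as (k & [-> | ->] & _ & ->);
          destruct Hm as [M1 M2]; rewrite delta_refl in *; lra.
      * exists e. split; auto. intros _ x y Mx Sy. rewrite (midpoint_unique _ _ x m Hne Mx Hm).
        apply H; auto. apply segment_left.
    + exists 1. split; [lra|]. intros. contradiction.
Qed.

(** Makes the family defining [epsilon_P] non-empty, so that the minimum of the two constants is
    finite even for a triangle. *)
Lemma adjacent_0_1 : adjacent n 0 1.
Proof.
  assert (Hn := polygon_size _ _ _ HP). split; [lia|]. exists 1%nat. split; [right|left; auto].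
  unfold next. rewrite Nat.mod_small; lia.
Qed.

Lemma separation_constant : exists m, 0 < m /\
  Rbar_min (delta_P n v) (Rbar_mult 2 (epsilon_P n v)) = Finite m /\
  (forall i j x y, (i < n)%nat -> (j < n)%nat -> non_adjacent n i j ->
     side n v i x -> side n v j y -> m <= delta x y) /\
  (forall i j x y, (i < n)%nat -> (j < n)%nat -> adjacent n i j ->
     midpoint (v i) (v (next n i)) x -> side n v j y -> m <= 2 * delta x y).
Proof.
  assert (Hn := polygon_size _ _ _ HP).
  destruct sides_far as (e1 & He1 & H1). destruct midpoints_far as (e2 & He2 & H2).
  assert (G2 : exists r, epsilon_P n v = Finite r /\ e2 <= r /\
    forall i j x y, (i < n)%nat -> (j < n)%nat -> adjacent n i j ->
     midpoint (v i) (v (next n i)) x -> side n v j y -> r <= delta x y).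
  { destruct (Glb_ge (fun d => exists i j m y, (i < n)%nat /\ (j < n)%nat /\ adjacent n i j /\
      midpoint (v i) (v (next n i)) m /\ side n v j y /\ d = delta m y) e2) as [[_ N]|(r & Er & Hr & K)].
    - intros d (i & j & x & y & Hi & Hj & A & Mx & Sy & ->). now apply (H2 i j Hi Hj A).
    - exfalso. destruct (midpoint_exists _ _ (side_ends_neq 0 ltac:(lia))) as (m & Hm).
      apply (N (delta m (v 1%nat))). exists 0%nat, 1%nat, m, (v 1%nat). repeat split; try lia; try apply Hm.
      + apply adjacent_0_1.
      + apply segment_left.
    - exists r. split; [exact Er|]. split; auto. intros i j x y Hi Hj A Mx Sy. apply K.
      exists i, j, x, y. auto 10. }
  destruct G2 as (r & Er & Hr & K2). rewrite Er.
  replace (Rbar_mult 2 (Finite r)) with (Finite (2 * r)) by reflexivity.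
  destruct (Glb_ge (fun d => exists i j x y, (i < n)%nat /\ (j < n)%nat /\ non_adjacent n i j /\
      side n v i x /\ side n v j y /\ d = delta x y) e1) as [[Ep N]|(s & Es & Hs & K)].
  - intros d (i & j & x & y & Hi & Hj & A & Mx & Sy & ->). now apply (H1 i j Hi Hj A).
  - change (delta_P n v = p_infty) in Ep. rewrite Ep. exists (2 * r). split; [lra|]. split; [reflexivity|]. split.
    + intros i j x y Hi Hj A Sx Sy. exfalso. apply (N (delta x y)). exists i, j, x, y. auto 10.
    + intros i j x y Hi Hj A Mx Sy. specialize (K2 i j x y Hi Hj A Mx Sy). lra.
  - change (delta_P n v = Finite s) in Es. rewrite Es. exists (Rmin s (2 * r)).
    split; [apply Rmin_pos; lra|]. split; [reflexivity|]. split.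
    + intros i j x y Hi Hj A Sx Sy. eapply Rle_trans; [apply Rmin_l|]. apply K. exists i, j, x, y. auto 10.
    + intros i j x y Hi Hj A Mx Sy. eapply Rle_trans; [apply Rmin_r|]. specialize (K2 i j x y Hi Hj A Mx Sy). lra.
Qed.

(** One argument after the other is moved to a vertex by [delta_le_vertex], without decreasing the
    distance. *)
Lemma vertex_diameter : exists d, 0 <= d /\ max_vertex_distance n v = Finite d /\
  forall z w, P z -> P w -> delta z w <= d.
Proof.
  assert (Hn := polygon_size _ _ _ HP).
  destruct (compact_bounded P (v 0%nat) (polygon_compact _ _ _ HP)) as (M & HM).
  set (E := fun d => exists i j, (i < n)%nat /\ (j < n)%nat /\ d = delta (v i) (v j)).
  change (max_vertex_distance n v) with (Lub_Rbar E).
  destruct (Lub_Rbar_correct E) as [U L].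
  assert (E0 : E 0) by (exists 0%nat, 0%nat; rewrite delta_refl; repeat split; lia).
  assert (B : Rbar_le (Lub_Rbar E) (2 * M)).
  { apply L. intros d (i & j & Hi & Hj & ->). simpl.
    pose proof (delta_triangle (v i) (v 0%nat) (v j)). rewrite (deltaC (v i) (v 0%nat)) in *.
    pose proof (HM _ (vertex_in _ _ _ HP i Hi)). pose proof (HM _ (vertex_in _ _ _ HP j Hj)). lra. }
  assert (U0 := U 0 E0). destruct (Lub_Rbar E) as [d| |]; try contradiction.
  exists d. split; [exact U0|]. split; auto. intros z w Pz Pw.
  destruct (delta_le_vertex _ _ _ HP z w Pz) as (i & Hi & Ki).
  destruct (delta_le_vertex _ _ _ HP w (v i) Pw) as (j & Hj & Kj).
  assert (K := U (delta (v j) (v i)) (ex_intro _ j (ex_intro _ i (conj Hj (conj Hi eq_refl))))).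
  simpl in K. rewrite (deltaC w) in Kj. lra.
Qed.

Lemma kstar_spec m d : 0 < m -> 0 <= d ->
  Rbar_min (delta_P n v) (Rbar_mult 2 (epsilon_P n v)) = Finite m ->
  max_vertex_distance n v = Finite d ->
  (0 < kstar n v)%nat /\ d < INR (kstar n v) * m.
Proof.
  intros Hm Hd Em Ed. unfold kstar. rewrite Em, Ed.
  change (real (Rbar_div d m)) with (d * / m).
  (* [Int_part r > r - 1]: the summand 1 in [kstar] makes the inequality strict. *)
  destruct (base_Int_part (1 + d * / m)) as [_ B].
  assert (Q : 0 <= d * / m) by (apply Rmult_le_pos; auto; left; now apply Rinv_0_lt_compat).
  set (z := Int_part (1 + d * / m)) in *.
  assert (Hz : d * / m < IZR z) by lra.
  assert (Hz0 : (0 < z)%Z) by (apply lt_IZR; lra).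
  split; [lia|]. rewrite INR_IZR_INZ, Z2Nat.id by lia.
  replace d with (d * / m * m) by (field; lra). now apply Rmult_lt_compat_r.
Qed.

End Constants.

(** * General position *)

(** Lines are avoided one at a time inside shrinking balls. The guard [bil N N < 0] admits
    degenerate vectors in the list, such as the [cross] of a point with itself. *)
Lemma ball_off_lines (l : list vec) : forall z e, 0 < e ->
  exists w e', 0 < e' /\ (forall x, delta w x < e' -> delta z x < e) /\
    forall x N, delta w x < e' -> In N l -> bil N N < 0 -> bil N (emb x) <> 0.
Proof.
  induction l as [|N l IH]; intros z e He.
  - exists z, e. split; [exact He|]. split; [auto|]. intros x N _ HN. destruct HN.
  - assert (H : exists w, delta z w < e /\ (bil N N < 0 -> bil N (emb w) <> 0)).
    { destruct (classic (bil N (emb z) = 0)) as [H0|H0]; [|exists z; rewrite delta_refl; auto].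
      destruct (Rlt_or_le (bil N N) 0) as [HN|HN].
      - destruct (ball_off_line N z e H0 HN He) as [(w & Hw & K) _]. exists w. split; auto. intros _; lra.
      - exists z. rewrite delta_refl. split; auto. intros; lra. }
    destruct H as (w & Hw & Kw).
    assert (H : exists e1, 0 < e1 /\ forall x, delta w x < e1 -> bil N N < 0 -> bil N (emb x) <> 0).
    { destruct (Rlt_or_le (bil N N) 0) as [HN|HN].
      - specialize (Kw HN). destruct (halfplane_open_sign N (bil N (emb w)) w) as (e1 & He1 & K); [nra|].
        exists e1. split; auto. intros x Hx _ E. specialize (K x Hx). rewrite E in K. lra.
      - exists 1. split; [lra|]. intros; lra. }
    destruct H as (e1 & He1 & K1).
    destruct (IH w (Rmin e1 (e - delta z w))) as (w' & e' & He' & Sub & K); [apply Rmin_pos; lra|].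
    exists w', e'. split; auto. split.
    + intros x Hx. apply ball_trans with w; auto. eapply Rlt_le_trans; [apply Sub, Hx|apply Rmin_r].
    + intros x N' Hx [<-|HN'] HN; [|now apply (K x)]. apply K1; auto.
      eapply Rlt_le_trans; [apply Sub, Hx|apply Rmin_l].
Qed.

(** Fix two distinct points [x] and [y]. Each point of [l] lies on a genuine line through one of
    them, so it is enough to avoid finitely many lines. *)
Lemma ball_avoiding_points (l : list H2) z e : 0 < e -> exists w, delta z w < e /\ ~ In w l.
Proof.
  intros He.
  assert (Two : exists x y : H2, x <> y).
  { exists (unemb (Vec 1 0 0)), (unemb (Vec (cosh 1) (sinh 1) 0)). intros E. apply (f_equal emb) in E.
    pose proof (cosh_sqr 1). pose proof (cosh_pos 1). assert (0 < sinh 1) by (apply sinh_gt0; lra).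
    rewrite !emb_unemb in E; [injection E; lra| |]; split; unfold bil; simpl; lra. }
  destruct Two as (x & y & Hxy).
  destruct (ball_off_lines (map (fun f => cross (emb f) (emb x)) l ++ map (fun f => cross (emb f) (emb y)) l) z e He)
    as (w & e' & He' & Sub & K).
  exists w. assert (Hww : delta w w < e') by now rewrite delta_refl. split; [now apply Sub|].
  intros Hin. assert (N : exists t, t <> w /\ (t = x \/ t = y)).
  { destruct (classic (x = w)) as [<-|]; [exists y|exists x]; auto. }
  destruct N as (t & Ht & Ht').
  apply (K w (cross (emb w) (emb t)) Hww).
  - apply in_or_app. destruct Ht' as [-> | ->]; [left|right];
      apply (in_map (fun f => cross (emb f) (emb _))); auto.
  - apply cross_neg; auto.
  - apply bil_cross_l.
Qed.

Lemma list_argmin {A} (f : A -> R) (Q : A -> Prop) (l : list A) : (exists x, In x l /\ Q x) ->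
  exists x, Q x /\ forall y, In y l -> Q y -> f x <= f y.
Proof.
  induction l as [|a l IH]; intros (x & Hx & Qx); [destruct Hx|].
  destruct (classic (exists x, In x l /\ Q x)) as [H|H].
  - destruct (IH H) as (x1 & Q1 & M1). destruct (classic (Q a)) as [Qa|Qa].
    + destruct (Rle_or_lt (f x1) (f a)) as [K|K].
      * exists x1. split; auto. intros y [<-|Hy] Qy; auto.
      * exists a. split; auto. intros y [<-|Hy] Qy; [lra|]. specialize (M1 y Hy Qy). lra.
    + exists x1. split; auto. intros y [<-|Hy] Qy; [contradiction|auto].
  - exists x. split; auto. intros y [<-|Hy] Qy; [|exfalso; eauto].
    destruct Hx as [<-|Hx]; [lra|exfalso; eauto].
Qed.

(** * From generic pairs to all pairs of points *)

Section Main.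
Variables (G : (H2 -> H2) -> Prop) (n : nat) (v : nat -> H2) (P : H2 -> Prop).
Hypotheses (HG : Fuchsian G) (HP : fundamental_polygon G n v P).

(** Every element of [T] sends some vertex of [P] into [P], and [P] is compact, so discontinuity
    applies. *)
Lemma Tset_finite : exists l, forall t, Tset G n v P t -> In t l.
Proof.
  assert (HC := proj1 HP). assert (Hn := polygon_size _ _ _ HC).
  destruct (proj2 HG P (polygon_compact _ _ _ HC)) as (l & Hl). exists l. intros t [Gt H]. apply Hl; auto.
  destruct H as [H|(_ & [(i & j & Hi & Hj & S)|(i & j & Hi & Hj & E)])].
  - exists (v 0%nat). assert (P0 : P (v 0%nat)) by (apply (vertex_in _ _ _ HC); lia). split; auto.
    apply H. now exists (v 0%nat).
  - exists (v j). split; [now apply (vertex_in _ _ _ HC)|]. apply (side_subset _ _ _ HC i); auto.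
    apply S. exists (v j). split; auto. apply segment_left.
  - exists (v j). rewrite E. split; now apply (vertex_in _ _ _ HC).
Qed.

Lemma set_pow_finite k : exists l, forall h, set_pow (Tset G n v P) k h -> In h l.
Proof.
  destruct Tset_finite as (lT & HT). induction k as [|k (l & Hl)].
  - exists ((fun z => z) :: nil). intros h ->. now left.
  - exists (flat_map (fun t => map (fun h z => t (h z)) l) lT). intros h (t & h' & Ht & Hh' & ->).
    apply in_flat_map. exists t. split; auto. apply (in_map (fun h z => t (h z))). auto.
Qed.

(** [z'] is chosen outside [F], so that each point of [F] spans a line with it; then [g w'] is
    chosen off these lines. *)
Lemma general_position g z w e (F : list H2) : G g -> P z -> P w -> 0 < e ->
  exists z' w', delta z z' < e /\ delta w w' < e /\ interior P z' /\ interior P w' /\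
    forall f, In f F -> ~ segment z' (g w') f.
Proof.
  intros Gg Pz Pw He. assert (HC := proj1 HP).
  destruct (interior_dense _ _ _ HC z (e / 2) Pz ltac:(lra)) as (z0 & Hz0 & Iz0).
  destruct (interior_dense _ _ _ HC w (e / 2) Pw ltac:(lra)) as (w0 & Hw0 & Iw0).
  destruct (interior_open _ _ Iz0) as (r1 & Hr1 & K1). destruct (interior_open _ _ Iw0) as (r2 & Hr2 & K2).
  destruct (ball_avoiding_points F z0 (Rmin r1 (e / 2))) as (z' & Hz' & Nz'); [apply Rmin_pos; lra|].
  destruct (ball_off_lines (map (fun f => cross (emb z') (emb f)) F) (g w0) (Rmin r2 (e / 2)))
    as (y & e' & He' & Sub & K); [apply Rmin_pos; lra|].
  assert (Hyy : delta y y < e') by now rewrite delta_refl.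
  destruct (G_inverse G (proj1 HG) g Gg) as (g' & Gg' & I1 & I2).
  assert (Hw' : delta w0 (g' y) < Rmin r2 (e / 2)).
  { rewrite <- (G_isometry G (proj1 HG) g) by auto. rewrite I2. now apply Sub. }
  exists z', (g' y).
  assert (A1 := Rlt_le_trans _ _ _ Hz' (Rmin_l _ _)). assert (A2 := Rlt_le_trans _ _ _ Hz' (Rmin_r _ _)).
  assert (A3 := Rlt_le_trans _ _ _ Hw' (Rmin_l _ _)). assert (A4 := Rlt_le_trans _ _ _ Hw' (Rmin_r _ _)).
  split; [pose proof (delta_triangle z z0 z'); lra|].
  split; [pose proof (delta_triangle w w0 (g' y)); lra|].
  split; [now apply K1|]. split; [now apply K2|].
  intros f Hf S. rewrite I2 in S.
  assert (Hfz : z' <> f) by (intros <-; auto).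
  apply (K y (cross (emb z') (emb f)) Hyy).
  - now apply (in_map (fun f => cross (emb z') (emb f))).
  - now apply cross_neg.
  - destruct (segment_lin _ _ _ S) as (s & t & _ & _ & E). rewrite E.
    unfold bil, cross, lin. cbn [c0 c1 c2]. ring.
Qed.

Lemma kstar_sufficient z w g : P z -> P w -> G g ->
  exists h, set_pow (Tset G n v P) (kstar n v) h /\ delta z (h w) <= delta z (g w).
Proof.
  intros Pz Pw Gg. assert (HC := proj1 HP).
  destruct (separation_constant n v P HC) as (m & Hm & Em & Hfar & Hmid).
  destruct (vertex_diameter n v P HC) as (d & Hd & Ed & Hdiam).
  destruct (kstar_spec n v m d Hm Hd Em Ed) as [Hk Hkd].
  set (k := kstar n v) in *.
  assert (Hid : set_pow (Tset G n v P) k (fun z => z)).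
  { apply (set_pow_le G n v P (proj1 HG) 0); [lia|]. reflexivity. }
  (* At distance [d] or more, the identity does at least as well as [g]. *)
  destruct (Rle_or_lt d (delta z (g w))) as [Hfar'|Hnear].
  { exists (fun z => z). split; auto. specialize (Hdiam z w Pz Pw). lra. }
  destruct (set_pow_finite k) as (lk & Hlk). destruct Tset_finite as (lT & HlT).
  (* Half of the gap for each point keeps the perturbed distance below [d]. The list holds the
     vertices of all tiles [h P] with [h] in [lk]. *)
  destruct (general_position g z w ((d - delta z (g w)) / 2)
    (flat_map (fun h => map (fun i => h (v i)) (seq 0 n)) lk)) as (z' & w' & Hz & Hw & Iz & Iw & Hav); auto; [lra|].
  assert (Hd' : delta z' (g w') < d).
  { pose proof (delta_triangle z' z (g w')). pose proof (delta_triangle z (g w) (g w')).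
    rewrite (G_isometry G (proj1 HG) g) in * by auto. rewrite (deltaC z' z) in *. lra. }
  destruct (G_inverse G (proj1 HG) g Gg) as (g' & Gg' & I1 & I2).
  assert (Iso : forall x y, delta (g x) (g y) = delta x y) by (intros; now apply (G_isometry G (proj1 HG))).
  assert (Ig : interior (image g P) (g w')) by (apply (interior_image g g'); auto; now rewrite I1).
  assert (R : exists h, set_pow (Tset G n v P) k h /\ forall x, g x = h x).
  (* Coinciding points give no direction, but then [P] and [g P] share an interior point and [g] is
     the identity. *)
  { destruct (classic (z' = g w')) as [Ez|Nz].
    - exists (fun z => z). split; auto. intros x.
      apply (common_interior_eq G n v P (proj1 HG) HP g (fun z => z) (g w')); auto; [apply G_id, HG|].
      rewrite <- Ez. destruct Iz as (e & He & H). exists e. split; auto. intros y Hy. exists y. split; auto.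
    - assert (T := tangent_dir z' (g w') Nz).
      apply (path_reached G n v P (proj1 HG) HP z' (dir z' (g w')) (delta z' (g w')) T m k lT g); auto.
      + intros h Hh s i Hs Hi E. apply (Hav (h (v i))).
        * apply in_flat_map. exists h. split; auto. apply (in_map (fun i => h (v i))). apply in_seq. lia.
        * rewrite <- E. now apply segment_geod_dir_in.
      + now rewrite geod_dir_end.
      + apply delta_ge0.
      + lra. }
  destruct R as (h & Hh & Egh). exists h. split; auto. rewrite Egh. lra.
Qed.

(** Finiteness of the power of [T] turns the infimum over [G] into an attained minimum. *)
Lemma computes_kstar : computes_delta_star G P (set_pow (Tset G n v P) (kstar n v)).
Proof.
  intros z w Pz Pw. destruct (set_pow_finite (kstar n v)) as (lk & Hlk).
  destruct (kstar_sufficient z w (fun z => z) Pz Pw (G_id G (proj1 HG))) as (h1 & Hh1 & _).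
  destruct (list_argmin (fun h => delta z (h w)) (set_pow (Tset G n v P) (kstar n v)) lk) as (h & Hh & M).
  { exists h1. split; auto. }
  assert (E : delta_star G z w = delta z (h w)).
  { unfold delta_star. rewrite (is_glb_Rbar_unique _ (Finite (delta z (h w)))); [reflexivity|]. split.
    - intros x (g & Gg & ->). destruct (kstar_sufficient z w g Pz Pw Gg) as (h2 & Hh2 & K).
      apply Rle_trans with (delta z (h2 w)); auto.
    - intros b Hb. apply Hb. exists h. split; auto. now apply (set_pow_G G n v P (proj1 HG) (kstar n v)). }
  rewrite E. split; [now exists h|]. intros x (h2 & Hh2 & ->). auto.
Qed.

End Main.

Lemma least_nat (Q : nat -> Prop) k : Q k -> exists j, Q j /\ (j <= k)%nat /\ forall i, Q i -> (j <= i)%nat.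
Proof.
  induction k as [k IH] using lt_wf_ind. intros Hk.
  destruct (classic (exists i, (i < k)%nat /\ Q i)) as [(i & Hi & Qi)|N].
  - destruct (IH i Hi Qi) as (j & Hj & Hji & M). exists j.
    split; [exact Hj|]. split; [lia|exact M].
  - exists k. split; [exact Hk|]. split; [lia|].
    intros i Qi. apply Nat.nlt_ge. intros Hi. eauto.
Qed.

Theorem mainTheorem1 (G : (H2 -> H2) -> Prop)
    (n : nat) (v : nat -> H2) (P : H2 -> Prop)
    (HG : Fuchsian G) (Hfg : finitely_generated G) (Hfk : first_kind G)
    (HP : fundamental_polygon G n v P) :
  (forall z w, P z -> P w ->
     is_min (fun d => exists g, set_pow (Tset G n v P) (kstar n v) g /\
                                d = delta z (g w))
            (delta_star G z w)) /\
  (exists kmin, is_k_min G n v P kmin /\ (kmin <= kstar n v)%nat).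
Proof.
  assert (HK := computes_kstar G n v P HG HP). split; [exact HK|].
  assert (HC := proj1 HP).
  destruct (separation_constant n v P HC) as (m & Hm & Em & _).
  destruct (vertex_diameter n v P HC) as (d & Hd & Ed & _).
  destruct (kstar_spec n v m d Hm Hd Em Ed) as [Hk _].
  destruct (least_nat (fun k => (0 < k)%nat /\ computes_delta_star G P (set_pow (Tset G n v P) k))
    (kstar n v) (conj Hk HK)) as (kmin & [K0 K1] & Kle & KM).
  exists kmin. split; auto. split; auto.
Qed.
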